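(* Let $(\Omega,\mathscr{H},\widehat{\mathbb E})$ be a sub-linear expectation space with conjugate expectation $\widehat{\mathcal E}$ and generated capacity $\mathbb V$. For a sequence $\{X_n;n\ge1\}$ in $\mathscr{H}$ put $S_n=\sum_{k=1}^nX_k$. (a) Let $\{X_n;n\ge1\}$ be a sequence of negatively dependent and identically distributed random variables. Suppose that $\mathbb V$ is countably sub-additive, $C_{\mathbb V}[|X_1|]<\infty$ and $\lim_{c\to\infty}\widehat{\mathbb E}[(|X_1|-c)^+]=0$. Then $$\mathbb V\Big(\Big\{\liminf_{n\to\infty}\frac{S_n}{n}<\widehat{\mathcal E}[X_1]\Big\}\cup\Big\{\limsup_{n\to\infty}\frac{S_n}{n}>\widehat{\mathbb E}[X_1]\Big\}\Big)=0.$$ (b) Suppose that $\{X_n;n\ge1\}$ is a sequence of independent and identically distributed random variables, and $\mathbb V$ is continuous. If $$\mathbb V\Big(\limsup_{n\to\infty}\frac{|S_n|}{n}=+\infty\Big)<1,$$ then $C_{\mathbb V}[|X_1|]<\infty$. (c) Suppose that $\{X_n;n\ge1\}$ is a sequence of independent and identically distributed random variables with $C_{\mathbb V}[|X_1|]<\infty$ and $\lim_{c\to\infty}\widehat{\mathbb E}[(|X_1|-c)^+]=0$. If $\mathbb V$ is continuous, then $$\mathbb V\Big(\liminf_{n\to\infty}\frac{S_n}{n}=\widehat{\mathcal E}[X_1]\ \text{ and }\ \limsup_{n\to\infty}\frac{S_n}{n}=\widehat{\mathbb E}[X_1]\Big)=1$$ and $$\mathbb V\Big(C\Big\{\frac{S_n}{n}\Big\}=\big[\widehat{\mathcal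 E}[X_1],\widehat{\mathbb E}[X_1]\big]\Big)=1,$$ where $C(\{x_n\})$ denotes the cluster set of a sequence $\{x_n\}$ in $\mathbb R$.
   Context: Let $(\Omega,\mathcal F)$ be a measurable space. $C_{l,Lip}(\mathbb R^n)$ is the linear space of functions $\varphi:\mathbb R^n\to\mathbb R$ such that $|\varphi(x)-\varphi(y)|\le C(1+|x|^m+|y|^m)|x-y|$ for all $x,y\in\mathbb R^n$, for some $C>0$, $m\in\mathbb N$ depending on $\varphi$. $\mathscr H$ is a linear space of real ($\mathcal F$-measurable) functions on $(\Omega,\mathcal F)$ (called random variables) such that $X_1,\ldots,X_n\in\mathscr H$ implies $\varphi(X_1,\ldots,X_n)\in\mathscr H$ for every $\varphi\in C_{l,Lip}(\mathbb R^n)$. A sub-linear expectation on $\mathscr H$ is a functional $\widehat{\mathbb E}:\mathscr H\to[-\infty,\infty]$ such that for all $X,Y\in\mathscr H$: (a) $X\ge Y$ implies $\widehat{\mathbb E}[X]\ge\widehat{\mathbb E}[Y]$; (b) $\widehat{\mathbb E}[c]=c$ for constants $c$; (c) $\widehat{\mathbb E}[X+Y]\le\widehat{\mathbb E}[X]+\widehat{\mathbb E}[Y]$ whenever the right side is not of the form $+\infty-\infty$ or $-\infty+\infty$; (d) $\widehat{\mathbb E}[\lambda X]=\lambda\widehat{\mathbb E}[X]$ for $\lambda\ge0$. The triple $(\Omega,\mathscr H,\widehat{\mathbb E})$ is called a sub-linear expectation space. The conjugate expectation is $\widehat{\mathcal E}[X]:=-\widehat{\mathbb E}[-X]$. Independence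 (not symmetric): a random vector $\mathbf Y=(Y_1,\ldots,Y_n)$, $Y_i\in\mathscr H$, is independent to $\mathbf X=(X_1,\ldots,X_m)$, $X_i\in\mathscr H$, if for each $\varphi\in C_{l,Lip}(\mathbb R^m\times\mathbb R^n)$ one has $\widehat{\mathbb E}[\varphi(\mathbf X,\mathbf Y)]=\widehat{\mathbb E}\big[\widehat{\mathbb E}[\varphi(\mathbf x,\mathbf Y)]\big|_{\mathbf x=\mathbf X}\big]$ whenever $\overline\varphi(\mathbf x):=\widehat{\mathbb E}[|\varphi(\mathbf x,\mathbf Y)|]<\infty$ for all $\mathbf x$ and $\widehat{\mathbb E}[|\overline\varphi(\mathbf X)|]<\infty$. Negative dependence: $\mathbf Y=(Y_1,\ldots,Y_n)$, $Y_i\in\mathscr H$, is negatively dependent to $\mathbf X=(X_1,\ldots,X_m)$, $X_i\in\mathscr H$, if for each pair $\varphi_1\in C_{l,Lip}(\mathbb R^m)$, $\varphi_2\in C_{l,Lip}(\mathbb R^n)$ one has $\widehat{\mathbb E}[\varphi_1(\mathbf X)\varphi_2(\mathbf Y)]\le\widehat{\mathbb E}[\varphi_1(\mathbf X)]\,\widehat{\mathbb E}[\varphi_2(\mathbf Y)]$ whenever $\varphi_1(\mathbf X)\ge0$, $\widehat{\mathbb E}[\varphi_2(\mathbf Y)]\ge0$, $\widehat{\mathbb E}[|\varphi_1(\mathbf X)\varphi_2(\mathbf Y)|]<\infty$, $\widehat{\mathbb E}[|\varphi_1(\mathbf X)|]<\infty$, $\widehat{\mathbb E}[|\varphi_2(\mathbf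 Y)|]<\infty$, and either $\varphi_1,\varphi_2$ are both coordinatewise nondecreasing or both coordinatewise non-increasing. A sequence $\{X_n;n\ge1\}$ in $\mathscr H$ is called independent (resp. negatively dependent) if $X_{i+1}$ is independent (resp. negatively dependent) to $(X_1,\ldots,X_i)$ for each $i\ge1$. It is identically distributed if for each $i\ge1$, $\widehat{\mathbb E}[\varphi(X_i)]=\widehat{\mathbb E}[\varphi(X_1)]$ for all $\varphi\in C_{l,Lip}(\mathbb R)$ whenever the sub-linear expectations are finite. The generated capacity is $\mathbb V(A):=\inf\{\widehat{\mathbb E}[\xi]: I_A\le\xi,\ \xi\in\mathscr H\}$, $A\in\mathcal F$. The Choquet integral is $C_{\mathbb V}[X]=\int_0^\infty\mathbb V(X\ge t)\,dt+\int_{-\infty}^0[\mathbb V(X\ge t)-1]\,dt$. $\mathbb V$ is countably sub-additive if $\mathbb V(\bigcup_{n=1}^\infty A_n)\le\sum_{n=1}^\infty\mathbb V(A_n)$ for all $A_n\in\mathcal F$. $\mathbb V$ is continuous if it is continuous from below ($\mathbb V(A_n)\uparrow\mathbb V(A)$ whenever $A_n\uparrow A$, $A_n,A\in\mathcal F$) and continuous from above ($\mathbb V(A_n)\downarrow\mathbb V(A)$ whenever $A_n\downarrow A$, $A_n,A\in\mathcal F$). The cluster set of a real sequence is the set of all its limit points (limits in $\mathbb R$ of subsequences). $x^+=\max(x,0)$. *)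

(* Defs.v *)
From HB Require Import structures.
From mathcomp Require Import all_boot all_order all_algebra.
From mathcomp Require Import all_classical all_reals all_analysis.

Set Implicit Arguments.
Unset Strict Implicit.
Unset Printing Implicit Defensive.

Import Order.TTheory GRing.Theory Num.Theory.
Import numFieldNormedType.Exports.

Local Open Scope classical_set_scope.
Local Open Scope ring_scope.

(* The class C_{l,Lip}(V). For V = 'rV[R]_n the library norm is the max norm; as
   all norms on R^n are equivalent, the class does not depend on this choice. *)
Definition clLip (R : realType) (V : normedModType R) (phi : V -> R) : Prop :=
  exists (C : R) (m : nat), 0 < C /\
    forall x y : V,
      `|phi x - phi y| <= C * (1 + `|x| ^+ m + `|y| ^+ m) * `|x - y|.

Definition nondecreasing_coord (R : realType) (n : nat) (phi : 'rV[R]_n -> R) :=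
  forall x y : 'rV[R]_n, (forall i, x 0 i <= y 0 i) -> phi x <= phi y.

Definition nonincreasing_coord (R : realType) (n : nat) (phi : 'rV[R]_n -> R) :=
  forall x y : 'rV[R]_n, (forall i, x 0 i <= y 0 i) -> phi y <= phi x.

Record rv_space d (Omega : measurableType d) (R : realType)
    (H : set (Omega -> R)) : Prop := {
  rv_measurable : forall X, H X -> measurable_fun setT X;
  rv_zero : H (fun=> 0);
  rv_add : forall X Y, H X -> H Y -> H (fun w => X w + Y w);
  rv_scale : forall (a : R) X, H X -> H (fun w => a * X w);
  rv_clLip : forall (n : nat) (X : 'I_n -> Omega -> R) (phi : 'rV[R]_n -> R),
    (forall i, H (X i)) -> clLip phi -> H (fun w => phi (\row_i X i w)) }.

(* The functional is represented by a total function E, but only its values on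
   H are constrained, and only these are used in the definitions below. *)
Record sublinear_expectation d (Omega : measurableType d) (R : realType)
    (H : set (Omega -> R)) (E : (Omega -> R) -> \bar R) : Prop := {
  sle_mono : forall X Y, H X -> H Y -> (forall w, Y w <= X w) ->
    (E Y <= E X)%E;
  sle_cst : forall c : R, E (fun=> c) = c%:E;
  sle_subadd : forall X Y, H X -> H Y -> (E X +? E Y)%E ->
    (E (fun w => (X w + Y w)%R) <= E X + E Y)%E;
  sle_scale : forall (a : R) X, H X -> 0 <= a ->
    E (fun w => a * X w) = (a%:E * E X)%E }.

Definition conjugate (Omega : Type) (R : realType)
    (E : (Omega -> R) -> \bar R) (X : Omega -> R) : \bar R :=
  (- E (fun w => (- X w)%R))%E.

(* When E[|phi(x, Y)|] < +oo for every x, both E[|phi(x, Y)|] and E[phi(x, Y)]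
   are real numbers, so [fine] loses nothing. The outer expectations are only
   defined when the composed functions belong to H, whence the two membership
   premises. *)
Definition independent_to (Omega : Type) (R : realType)
    (H : set (Omega -> R)) (E : (Omega -> R) -> \bar R) (m n : nat)
    (X : Omega -> 'rV[R]_m) (Y : Omega -> 'rV[R]_n) : Prop :=
  forall phi : 'rV[R]_m * 'rV[R]_n -> R, clLip phi ->
    let absphi x := E (fun w => `|phi (x, Y w)|) in
    let psi x := E (fun w => phi (x, Y w)) in
    (forall x, absphi x < +oo)%E ->
    H (fun w => fine (absphi (X w))) ->
    H (fun w => fine (psi (X w))) ->
    (E (fun w => `|fine (absphi (X w))|%R) < +oo)%E ->
    E (fun w => phi (X w, Y w)) = E (fun w => fine (psi (X w))).

Definition negatively_dependent_to (Omega : Type) (R : realType)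
    (E : (Omega -> R) -> \bar R) (m n : nat)
    (X : Omega -> 'rV[R]_m) (Y : Omega -> 'rV[R]_n) : Prop :=
  forall (phi1 : 'rV[R]_m -> R) (phi2 : 'rV[R]_n -> R),
    clLip phi1 -> clLip phi2 ->
    (forall w, 0 <= phi1 (X w)) ->
    (0 <= E (fun w => phi2 (Y w)))%E ->
    (E (fun w => `|phi1 (X w) * phi2 (Y w)|%R) < +oo)%E ->
    (E (fun w => `|phi1 (X w)|%R) < +oo)%E ->
    (E (fun w => `|phi2 (Y w)|%R) < +oo)%E ->
    (nondecreasing_coord phi1 /\ nondecreasing_coord phi2) \/
    (nonincreasing_coord phi1 /\ nonincreasing_coord phi2) ->
    (E (fun w => (phi1 (X w) * phi2 (Y w))%R) <=
      E (fun w => phi1 (X w)) * E (fun w => phi2 (Y w)))%E.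

(* Sequences are indexed from 0: [X k] is the random variable X_{k+1}. *)
Definition prefix_vec (Omega : Type) (R : realType) (X : nat -> Omega -> R)
  (i : nat) : Omega -> 'rV[R]_i := fun w => \row_(j < i) X j w.

Definition singleton_vec (Omega : Type) (R : realType) (X : Omega -> R)
  : Omega -> 'rV[R]_1 := fun w => \row_(j < 1) X w.

Definition independent_seq (Omega : Type) (R : realType)
    (H : set (Omega -> R)) (E : (Omega -> R) -> \bar R)
    (X : nat -> Omega -> R) : Prop :=
  forall i : nat,
    independent_to H E (prefix_vec X i.+1) (singleton_vec (X i.+1)).

Definition negatively_dependent_seq (Omega : Type) (R : realType)
    (E : (Omega -> R) -> \bar R) (X : nat -> Omega -> R) : Prop :=
  forall i : nat,
    negatively_dependent_to E (prefix_vec X i.+1) (singleton_vec (X i.+1)).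

Definition identically_distributed (Omega : Type) (R : realType)
    (E : (Omega -> R) -> \bar R) (X : nat -> Omega -> R) : Prop :=
  forall (i : nat) (phi : R^o -> R), clLip phi ->
    E (fun w => phi (X i w)) \is a fin_num ->
    E (fun w => phi (X 0%N w)) \is a fin_num ->
    E (fun w => phi (X i w)) = E (fun w => phi (X 0%N w)).

Definition capacity (Omega : Type) (R : realType) (H : set (Omega -> R))
    (E : (Omega -> R) -> \bar R) (A : set Omega) : \bar R :=
  ereal_inf [set E xi | xi in [set xi | H xi /\ forall w, \1_A w <= xi w]].

Definition choquet (Omega : Type) (R : realType) (V : set Omega -> \bar R)
    (X : Omega -> R) : \bar R :=
  (\int[lebesgue_measure]_(t in `[0%R, +oo[%classic) V [set w | t <= X w]%R +
   \int[lebesgue_measure]_(t in `]-oo, 0%R]%classic)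
     (V [set w | t <= X w]%R - 1))%E.

Definition countably_subadditive d (Omega : measurableType d) (R : realType)
    (V : set Omega -> \bar R) : Prop :=
  forall A : (set Omega)^nat, (forall n, measurable (A n)) ->
    (V (\bigcup_n A n) <= \sum_(0 <= n <oo) V (A n))%E.

Definition continuous_capacity d (Omega : measurableType d) (R : realType)
    (V : set Omega -> \bar R) : Prop :=
  (forall A : (set Omega)^nat, (forall n, measurable (A n)) ->
    nondecreasing_seq A -> V \o A @ \oo --> V (\bigcup_n A n)) /\
  (forall A : (set Omega)^nat, (forall n, measurable (A n)) ->
    nonincreasing_seq A -> V \o A @ \oo --> V (\bigcap_n A n)).

Definition partial_sum (Omega : Type) (R : realType) (X : nat -> Omega -> R)
  (n : nat) (w : Omega) : R := \sum_(k < n) X k w.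

(* Shifted by one to avoid the index n = 0: the n-th term is S_{n+1}/(n+1). *)
Definition sample_mean (Omega : Type) (R : realType) (X : nat -> Omega -> R)
  (w : Omega) : R^nat := fun n => partial_sum X n.+1 w / n.+1%:R.

Definition cluster_set (R : realType) (u : R^nat) : set R :=
  [set l | exists2 f : nat -> nat,
     {homo f : i j / (i < j)%N} & u \o f @ \oo --> l].

(* Main.v *)
Require Import Defs.
From mathcomp Require Import all_boot all_order all_algebra.
From mathcomp Require Import all_classical all_reals all_analysis.
From mathcomp Require Import measurable_realfun ring lra.
Set Implicit Arguments.
Unset Strict Implicit.
Unset Printing Implicit Defensive.
Import Order.TTheory GRing.Theory Num.Theory.
Import numFieldNormedType.Exports.
Local Open Scope classical_set_scope.
Local Open Scope ring_scope.

(** Why the theorem holds.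

    Strong law, part (a). Only one consequence of negative dependence is needed:
    for a bounded Lipschitz non-negative monotone [f], the expectation of
    [\prod_(k < n) f (X k)] is at most the n-th power of that of [f (X 0)]
    ([ev_prod_negatively_dependent]). For the upper half one adds a large
    constant [c] and cuts the variables from below at 0; this changes the mean by
    little thanks to the vanishing of [E (|X| - c)^+], and makes the partial sums
    monotone. Cutting also from above at a level [b] proportional to [n], an
    exponential Markov inequality bounds the capacity of a large deviation by a
    constant multiple of [n * second moment / b ^+ 2] plus [n] times a bound for
    the capacity of [X + c >= b] ([cap_positive_sum_le]). Finiteness of the Choquet integral makes both terms
    summable along [n = i * 2 ^ j] for each fixed [i], and Borel-Cantelli with
    monotonicity concludes ([upper_strong_law]). The lower half is the upper half
    for [- X]; [strong_law_null] combines the two.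

    Part (b). If the Choquet integral is infinite, so are the sums of the
    capacities of [|X k| >= M * k] for every [M]. Independence yields the second
    Borel-Cantelli lemma for the generated capacity ([cap_bigcup_eq1]), and
    continuity from above turns it into capacity 1 of
    [limsup |S_n| / n = +oo] ([choquet_lty_of_limsup_bounded]).

    Part (c). A continuous capacity leaves no room between the upper and the
    lower expectation of an independent identically distributed sequence
    ([mean_certainty]). If there were a gap, then long blocks could have their
    average on the upper side or on the lower side of a point of the gap, each
    with capacity close to 1 (the side is read off a product of exponentials,
    which independence makes computable), and by independence every infinite pattern of such
    choices would have capacity at least 1/2. Infinitely many disjoint patterns
    then contradict continuity from above at the empty set. Hence
    [E (X 0) = conjugate E (X 0)] ([mean_eq_conjugate]). A continuous capacity is
    countably sub-additive and independence gives the product bound, so the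
    argument of part (a) applies: off a set of capacity zero the averages converge
    to the common value, and both assertions of (c) follow. *)

(** * Bounded Lipschitz functions *)

Section BoundedLipschitz.
Variable R : realType.

(** One constant serves both as bound and as Lipschitz constant. These
    functions form an algebra inside the class [clLip] (which is closed under
    products too, but with growing exponents), and expectations of such
    functions of random variables are automatically finite. *)
Definition blip (V : normedModType R) (f : V -> R) : Prop :=
  exists2 K : R, 0 <= K &
    forall x y, `|f x| <= K /\ `|f x - f y| <= K * `|x - y|.

Lemma blip_clLip (V : normedModType R) (f : V -> R) : blip f -> clLip f.
Proof.
move=> [K K0 fK]; exists (K + 1), 0%N; split; first by rewrite ltr_wpDl.
move=> x y; have [_ /le_trans] := fK x y; apply.
rewrite !expr0 ler_wpM2r//; nra.
Qed.

Lemma blip_cst (V : normedModType R) (c : R) : blip (fun _ : V => c).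
Proof.
by exists `|c| => // x y; rewrite lexx subrr normr0 mulr_ge0.
Qed.

Lemma blipD (V : normedModType R) (f g : V -> R) :
  blip f -> blip g -> blip (fun x => f x + g x).
Proof.
move=> [K K0 fK] [L L0 gL]; exists (K + L); first exact: addr_ge0.
move=> x y; have [f1 f2] := fK x y; have [g1 g2] := gL x y; split.
  by rewrite (le_trans (ler_normD _ _))// lerD.
by rewrite opprD addrACA (le_trans (ler_normD _ _))// mulrDl lerD.
Qed.

Lemma blipM (V : normedModType R) (f g : V -> R) :
  blip f -> blip g -> blip (fun x => f x * g x).
Proof.
move=> [K K0 fK] [L L0 gL]; exists (2 * (K * L) + K * L); first by nra.
move=> x y; have [f1 f2] := fK x y; have [g1 g2] := gL x y.
have [fy _] := fK y x.
split.
  rewrite normrM (le_trans (ler_pM _ _ f1 g1))//.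
  by rewrite lerDr mulr_ge0// mulr_ge0.
have -> : f x * g x - f y * g y = (f x - f y) * g x + f y * (g x - g y) by ring.
rewrite (le_trans (ler_normD _ _))// !normrM.
apply: (@le_trans _ _ (K * `|x - y| * L + K * (L * `|x - y|))).
  by apply: lerD; apply: ler_pM.
have := normr_ge0 (x - y); set t := `|x - y| => t0.
have := mulr_ge0 (mulr_ge0 K0 L0) t0; lra.
Qed.

Lemma blipN (V : normedModType R) (f : V -> R) :
  blip f -> blip (fun x => - f x).
Proof.
by move=> [K K0 fK]; exists K => // x y; rewrite -opprD !normrN.
Qed.

Lemma blip_norm (V : normedModType R) (f : V -> R) :
  blip f -> blip (fun x => `|f x|).
Proof.
move=> [K K0 fK]; exists K => // x y; rewrite normr_id.
by have [f1 f2] := fK x y; split=> //; rewrite (le_trans (ler_dist_dist _ _)).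
Qed.

Lemma blip_comp (U V : normedModType R) (h : U -> V) (f : V -> R) :
  (forall x y, `|h x - h y| <= `|x - y|) -> blip f -> blip (f \o h).
Proof.
move=> hh [K K0 fK]; exists K => // x y /=; have [f1 f2] := fK (h x) (h y).
by split=> //; rewrite (le_trans f2)// ler_wpM2l.
Qed.

Lemma coord_norm_le n (x : 'rV[R]_n) i : `|x 0 i| <= `|x|.
Proof.
rewrite [leRHS]mx_normrE.
by rewrite (bigD1 (0, i)) //= le_max lexx.
Qed.

Lemma row_norm_le n (x : 'rV[R]_n) (K : R) : 0 <= K ->
  (forall i, `|x 0 i| <= K) -> `|x| <= K.
Proof.
move=> K0 xK; rewrite [leLHS]mx_normrE; apply: (big_ind (fun z => z <= K)) => //.
- by move=> a b aK bK; rewrite ge_max aK bK.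
- by move=> [i j] _ /=; rewrite (ord1 i) xK.
Qed.

Lemma blip_coord n (i : 'I_n) (f : R^o -> R) :
  blip f -> blip (fun x : 'rV[R]_n => f (x 0 i)).
Proof.
move=> ff; apply: (@blip_comp 'rV[R]_n R^o (fun x => x 0 i)) => // x y.
by have := coord_norm_le (x - y) i; rewrite !mxE.
Qed.

Lemma blip_prefix m n (mn : (m <= n)%N) (f : 'rV[R]_m -> R) : blip f ->
  blip (fun x : 'rV[R]_n => f (\row_(j < m) x 0 (widen_ord mn j))).
Proof.
move=> ff; apply: (@blip_comp 'rV[R]_n 'rV[R]_m
  (fun x => \row_(j < m) x 0 (widen_ord mn j))) => // x y.
apply: row_norm_le => // i; rewrite !mxE.
by have := coord_norm_le (x - y) (widen_ord mn i); rewrite !mxE.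
Qed.

Lemma blip_prod (V : normedModType R) (I : Type) (r : seq I) (f : I -> V -> R) :
  (forall k, blip (f k)) -> blip (fun x => \prod_(k <- r) f k x).
Proof.
move=> bf; elim: r => [|k r IH].
  by under eq_fun do rewrite big_nil; exact: blip_cst.
by under eq_fun do rewrite big_cons; exact: blipM.
Qed.

Definition clamp (lo hi x : R) : R := Num.min (Num.max x lo) hi.

Lemma clamp_ge lo hi x : lo <= hi -> lo <= clamp lo hi x.
Proof. by move=> h; rewrite /clamp le_min h le_max lexx orbT. Qed.

Lemma clamp_le lo hi x : clamp lo hi x <= hi.
Proof. by rewrite /clamp ge_min lexx orbT. Qed.

Lemma clamp_homo lo hi x y : x <= y -> clamp lo hi x <= clamp lo hi y.
Proof.
move=> xy; rewrite /clamp.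
by rewrite /Order.min /Order.max; case: (ltP x lo) => ?; case: (ltP y lo) => ?;
  do ![case: ltP => ?]; lra.
Qed.

Lemma clamp_lip lo hi x y : `|clamp lo hi x - clamp lo hi y| <= `|x - y|.
Proof.
wlog xy : x y / x <= y.
  move=> W; have [/W//|/ltW/W] := leP x y.
  by rewrite [in leLHS]distrC [in leRHS]distrC.
rewrite distrC ger0_norm ?subr_ge0 ?clamp_homo// distrC ger0_norm ?subr_ge0//.
rewrite /clamp.
by rewrite /Order.min /Order.max; case: (ltP x lo) => ?; case: (ltP y lo) => ?;
  do ![case: ltP => ?]; lra.
Qed.

Lemma blip_of_lip (f : R -> R) (K L : R) :
  (forall x, `|f x| <= K) -> (forall x y, `|f x - f y| <= L * `|x - y|) ->
  blip (f : R^o -> R).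
Proof.
move=> fK fL; have K0 : 0 <= K by rewrite (le_trans _ (fK 0)).
exists (K + `|L|); first by rewrite addr_ge0.
move=> x y; split; first by rewrite (le_trans (fK _))// lerDl.
rewrite (le_trans (fL _ _))// ler_wpM2r// (le_trans (ler_norm _))//.
by rewrite lerDr.
Qed.

Lemma blip_clamp lo hi : blip (clamp lo hi : R^o -> R).
Proof.
apply: (@blip_of_lip _ (`|lo| + `|hi|) 1) => [x|x y]; last first.
  by rewrite mul1r clamp_lip.
have h1 := ler_norm hi; have := ler_norm (- lo); have := ler_norm (- hi).
rewrite !normrN => h2 h3; rewrite ler_norml; apply/andP; split; last first.
  by rewrite (le_trans (clamp_le _ _ _))// (le_trans h1)// lerDr.
have n1 := normr_ge0 lo; have n2 := normr_ge0 hi.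
rewrite /clamp le_min; apply/andP; split; last by lra.
by rewrite le_max; apply/orP; right; lra.
Qed.

Lemma blip_clamp_shift lo hi c : blip (fun x : R^o => clamp lo hi (x + c)).
Proof.
apply: (@blip_comp R^o R^o (fun x => x + c) (clamp lo hi)); last exact: blip_clamp.
by move=> x y; rewrite opprD addrACA subrr addr0.
Qed.

Lemma lip_expR (B x y : R) : x <= B -> y <= B ->
  `|expR x - expR y| <= expR B * `|x - y|.
Proof.
wlog xy : x y / x <= y.
  move=> W xB yB; have [h|/ltW h] := leP x y; first exact: W.
  by rewrite distrC (distrC x) W.
move=> xB yB; rewrite distrC ger0_norm ?subr_ge0 ?ler_expR//.
rewrite distrC ger0_norm ?subr_ge0//.
have h1 := expR_ge1Dx (x - y); have h2 : expR y <= expR B by rewrite ler_expR.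
have e0 := expR_gt0 y.
have -> : expR x = expR y * expR (x - y) by rewrite -expRD; congr expR; lra.
nra.
Qed.

Lemma blip_expR_comp (f : R -> R) : blip (f : R^o -> R) ->
  blip (fun x : R^o => expR (f x)).
Proof.
move=> [K K0 fK].
have fle x : f x <= K by rewrite (le_trans (ler_norm _))//; have [] := fK x x.
apply: (@blip_of_lip _ (expR K) (expR K * K)) => [x|x y].
  by rewrite ger0_norm ?expR_ge0// ler_expR.
rewrite (le_trans (lip_expR (fle x) (fle y)))// -mulrA ler_wpM2l ?expR_ge0//.
by have [] := fK x y.
Qed.

(** In the exponential series at [u = t * b], every term of degree [k >= 2] is
    at most [t ^+ 2] times the corresponding term at [b], because
    [t ^+ k <= t ^+ 2]. The factor [(u / b) ^+ 2], rather than [u ^+ 2], is what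
    turns the exponential Markov bound below into a usable polynomial rate. *)
Lemma expR_quadratic_bound (u b : R) : 0 <= u -> 0 < b -> u <= b ->
  expR u <= 1 + u + (u / b) ^+ 2 * expR b.
Proof.
move=> u0 b0 ub; set t := u / b.
have t0 : 0 <= t by rewrite divr_ge0// ltW.
have t1 : t <= 1 by rewrite ler_pdivrMr// mul1r.
have utb : u = t * b by rewrite divfK// gt_eqF.
have step n : series (exp_coeff u) n.+2 <=
    1 + u + t ^+ 2 * series (exp_coeff b) n.+2.
  elim: n => [|n IH].
    rewrite !seriesEnat/= !big_nat_recr//= !big_geq//.
    rewrite /exp_coeff /= !expr0 !expr1 !fact0 (_ : 1`!%:R = 1 :> R)// !divr1.
    have : 0 <= t ^+ 2 * (0 + 1 + b).
      by rewrite mulr_ge0 ?exprn_ge0// addr_ge0// ltW.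
    lra.
  have rec (v : R) : series (exp_coeff v) n.+3 =
      series (exp_coeff v) n.+2 + exp_coeff v n.+2.
    by rewrite !seriesEnat/= big_nat_recr.
  rewrite !rec mulrDr addrA lerD// /exp_coeff /=.
  rewrite [u in u ^+ _]utb mulrA ler_wpM2r ?invr_ge0//.
  rewrite exprMn -[n.+2]addn2 exprD ler_wpM2r//.
    by rewrite exprn_ge0// ltW.
  by rewrite ler_piMl ?exprn_ge0// exprn_ile1.
have c1 := is_cvg_series_exp_coeff u; have c2 := is_cvg_series_exp_coeff b.
rewrite /expR; apply: limr_le => //.
near=> n.
have -> : n = (n - 2).+2 by rewrite -addn2 subnK//; near: n; exists 2%N.
rewrite (le_trans (step _))// lerD2l ler_wpM2l ?exprn_ge0//.
apply: nondecreasing_cvgn_le => //.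
apply: nondecreasing_series => k _ _.
by rewrite /exp_coeff /= divr_ge0// exprn_ge0// ltW.
Unshelve. all: by end_near. Qed.

End BoundedLipschitz.

(** * Dyadic interpolation, and integrals of monotone functions *)

Section RealAnalysis.
Variable R : realType.

(** For each fixed multiplier [i] the indices [i * 2 ^ j] grow geometrically,
    which makes Borel-Cantelli sums converge, while letting [i] range over
    [q, 2q] leaves gaps of relative size only [1 / q]. A monotone sequence that
    is controlled along each of these geometric sequences is therefore
    controlled everywhere, at the price of an arbitrarily small [delta]. *)
Lemma dyadic_interpolation (P : nat -> R) (K delta : R) :
  nondecreasing_seq P -> 0 <= K -> 0 < delta ->
  (forall i, (0 < i)%N -> exists J, forall j, (J <= j)%N ->
     P (i * 2 ^ j)%N <= (i * 2 ^ j)%:R * K) ->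
  exists N, forall n, (N <= n)%N -> P n <= n%:R * (K + delta).
Proof.
move=> Pnd K0 d0 PK.
(* relative gap 1 / q, chosen so that it costs at most delta *)
pose q := (Num.truncn (K / delta)).+1.
have Kq : K <= delta * q%:R.
  rewrite mulrC -ler_pdivrMr// ltW// /q.
  by have /andP[] := truncn_itv (divr_ge0 K0 (ltW d0)).
have {}PK i : exists J, (0 < i)%N -> forall j, (J <= j)%N ->
    P (i * 2 ^ j)%N <= (i * 2 ^ j)%:R * K.
  case: i => [|i]; first by exists 0%N.
  by have [//|J hJ] := PK i.+1; exists J.
have /choice[J hJ] := PK.
pose J0 := (\max_(i < (2 * q).+1) J i)%N.
exists (q * 2 ^ J0)%N => n nN.
pose j := trunc_log 2 (n %/ q).
have q0 : (0 < q)%N by [].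
have pJ : (2 ^ J0 <= n %/ q)%N by rewrite leq_divRL// mulnC.
have J0j : (J0 <= j)%N by exact: trunc_log_max.
have nq0 : (0 < n %/ q)%N by rewrite (leq_trans _ pJ)// expn_gt0.
have /andP[jn nj] := trunc_log_bounds (isT : (1 < 2)%N) nq0.
rewrite -/j in jn nj.
have qn : (q * 2 ^ j <= n)%N by rewrite mulnC -leq_divRL.
have nq : (n < q * 2 ^ j.+1)%N by rewrite mulnC -ltn_divLR.
have p0 : (0 < 2 ^ j)%N by rewrite expn_gt0.
(* i * 2 ^ j is the first multiple of 2 ^ j above n, and q < i <= 2 q *)
pose i := (n %/ 2 ^ j).+1.
have ni : (n <= i * 2 ^ j)%N by rewrite ltnW// -ltn_divLR.
have iN : (i * 2 ^ j <= n + 2 ^ j)%N by rewrite /i mulSn addnC leq_add2r leq_trunc_div.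
have i2q : (i < (2 * q).+1)%N.
  rewrite /i ltnS ltn_divLR// (leq_trans nq)// expnS mulnCA mulnA leqnn//.
have Ji : (J i <= j)%N.
  rewrite (leq_trans _ J0j)//.
  exact: (leq_bigmax (Ordinal i2q) (F := fun i : 'I_(2 * q).+1 => J i)).
have Pi := hJ i isT j Ji.
apply: (le_trans (Pnd _ _ ni)); apply: (le_trans Pi).
apply: (@le_trans _ _ ((n + 2 ^ j)%:R * K)).
  by apply: ler_wpM2r => //; rewrite ler_nat.
rewrite natrD mulrDl mulrDr lerD2l.
apply: (@le_trans _ _ ((2 ^ j)%:R * (delta * q%:R))); first by rewrite ler_wpM2l.
rewrite mulrCA mulrC; apply: ler_wpM2r; first exact: ltW.
by rewrite mulrC -natrM ler_nat.
Qed.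

Lemma ler_sum_nat_series (G : nat -> R) (B : R) :
  (forall k, 0 <= G k) -> (forall N, \sum_(k < N) G k <= B) ->
  (\sum_(0 <= k <oo) (G k)%:E <= B%:E)%E.
Proof.
move=> G0 GB; apply: lime_le.
  by apply: is_cvg_nneseries => n _ _; rewrite lee_fin.
by apply: nearW => N; rewrite sumEFin lee_fin big_mkord.
Qed.

Section MonotoneIntegral.
Variables (G : R -> R) (a : R).
Hypotheses (G0 : forall t, 0 <= G t) (G_ni : nonincreasing_fun G) (a0 : 0 < a).

Let cell (k : nat) : set R := `[a * k%:R, a * k.+1%:R[%classic.

Let cells : `[0%R, +oo[%classic = \bigcup_k cell k.
Proof.
apply/seteqP; split => t /=.
  rewrite in_itv/= andbT => t0; exists (Num.truncn (t / a)) => //=.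
  have /andP[h1 h2] := truncn_itv (divr_ge0 t0 (ltW a0)).
  rewrite /cell/= in_itv/=; apply/andP; split.
    by rewrite mulrC -ler_pdivlMr.
  by rewrite mulrC -ltr_pdivrMr.
move=> [k _]; rewrite /cell/= !in_itv/= andbT => /andP[+ _].
by apply: le_trans; rewrite mulr_ge0// ltW.
Qed.

Let integral_cells :
  (\int[lebesgue_measure]_(t in `[0%R, +oo[%classic) (G t)%:E =
   \sum_(0 <= k <oo) \int[lebesgue_measure]_(t in cell k) (G t)%:E)%E.
Proof.
rewrite cells ge0_integral_bigcup//.
- by move=> k; exact: measurable_itv.
- by apply/measurable_EFinP; apply: nonincreasing_measurable => //;
    apply: bigcup_measurable => k _; exact: measurable_itv.
- by move=> t _; rewrite lee_fin.
- apply: ltn_trivIset => m n mn; apply/seteqP; split => // t [].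
  rewrite /cell/= !in_itv/= => /andP[_ t1] /andP[t2 _].
  have : a * n.+1%:R <= a * m%:R by rewrite ler_wpM2l ?(ltW a0)// ler_nat.
  lra.
Qed.

Let integral_cst_cell k (c : R) :
  (\int[lebesgue_measure]_(t in cell k) c%:E = (a * c)%:E)%E.
Proof.
have mu_cell : lebesgue_measure (cell k) = a%:E.
  rewrite /cell lebesgue_measure_itv/= lte_fin ltr_pM2l// ltr_nat ltnSn -EFinD.
  by congr EFin; rewrite -natr1; lra.
rewrite integral_cst; last exact: measurable_itv.
by rewrite [X in (_ * X)%E]mu_cell -EFinM mulrC.
Qed.

Let mG D : measurable D -> measurable_fun D (EFin \o G).
Proof. by move=> mD; apply/measurable_EFinP; exact: nonincreasing_measurable. Qed.

Lemma integral_nonincreasing_lty (B : R) :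
  (forall N, \sum_(k < N) G (a * k.+1%:R) <= B) ->
  (\int[lebesgue_measure]_(t in `[0%R, +oo[%classic) (G t)%:E < +oo)%E.
Proof.
move=> GB; rewrite integral_cells.
apply: (@le_lt_trans _ _ (a * (G 0 + B))%:E); last exact: ltry.
apply: (@le_trans _ _ (\sum_(0 <= k <oo) (a * G (a * k%:R))%:E)%E).
  apply: lee_nneseries => [k _ _|k _].
    by apply: integral_ge0 => t _; rewrite lee_fin.
  rewrite -(integral_cst_cell k); apply: ge0_le_integral => //.
  - exact: measurable_itv.
  - by move=> t _; rewrite lee_fin.
  - by apply: mG; exact: measurable_itv.
  - by move=> t; rewrite /cell/= in_itv/= => /andP[h _]; rewrite lee_fin G_ni.
apply: ler_sum_nat_series => [k|[|N]]; first by rewrite mulr_ge0// ltW.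
  rewrite big_ord0 mulr_ge0// ?(ltW a0)// addr_ge0//.
  by have := GB 0%N; rewrite big_ord0.
rewrite big_ord_recl/= mulr0 -mulr_sumr -mulrDr ler_wpM2l ?(ltW a0)// lerD2l.
exact: GB.
Qed.

Lemma integral_nonincreasing_sum_bounded :
  (\int[lebesgue_measure]_(t in `[0%R, +oo[%classic) (G t)%:E < +oo)%E ->
  exists B, forall N, \sum_(k < N) G (a * k.+1%:R) <= B.
Proof.
set I := (X in (X < _)%E) => Ioo.
have I0 : (0 <= I)%E by apply: integral_ge0 => t _; rewrite lee_fin.
have Ifin : I \is a fin_num by rewrite ge0_fin_numE.
exists (fine I / a) => N; rewrite ler_pdivlMr// mulrC -lee_fin fineK//.
rewrite /I integral_cells mulr_sumr -sumEFin.
rewrite -(big_mkord xpredT (fun k => (a * G (a * k.+1%:R))%:E)).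
apply: le_trans (nneseries_lim_ge N _); last first.
  by move=> k _ _; apply: integral_ge0 => t _; rewrite lee_fin.
apply: lee_sum => k _; rewrite -(integral_cst_cell k); apply: ge0_le_integral => //.
- exact: measurable_itv.
- by move=> t _; rewrite lee_fin.
- by apply: mG; exact: measurable_itv.
- by move=> t; rewrite /cell/= in_itv/= => /andP[_ h]; rewrite lee_fin G_ni// ltW.
Qed.

End MonotoneIntegral.

(** Cauchy condensation. *)
Lemma condensation_bounded (G : nat -> R) (B : R) :
  (forall k, 0 <= G k) -> (forall m n, (m <= n)%N -> G n <= G m) ->
  (forall N, \sum_(k < N) G k.+1 <= B) ->
  forall N, \sum_(j < N) 2 ^+ j * G (2 ^ j)%N <= 2 * B.
Proof.
move=> G0 Gni GB.
suff key N : \sum_(j < N) 2 ^+ j * G (2 ^ j)%N <= 2 * \sum_(k < 2 ^ N) G k.+1.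
  by move=> N; rewrite (le_trans (key N))// ler_wpM2l.
case: N => [|N]; first by rewrite big_ord0 mulr_ge0// sumr_ge0.
suff : \sum_(j < N.+1) 2 ^+ j * G (2 ^ j)%N <= 2 * \sum_(k < 2 ^ N) G k.+1.
  move/le_trans; apply; rewrite ler_wpM2l// expnS mul2n -addnn big_split_ord/=.
  by rewrite lerDl sumr_ge0.
elim: N => [|N IH].
  by rewrite !expn0 !big_ord1 expr0 expn0 /=; have := G0 1%N; lra.
rewrite big_ord_recr/= (_ : (2 ^ N.+1)%N = (2 ^ N + 2 ^ N)%N); last first.
  by rewrite expnS mul2n addnn.
rewrite big_split_ord/= mulrDr lerD// exprS -mulrA ler_wpM2l//.
have -> : 2 ^+ N = \sum_(k < 2 ^ N) (1 : R).
  by rewrite sumr_const card_ord natrX.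
rewrite mulr_suml; apply: ler_sum => k _; rewrite mul1r; apply: Gni.
by rewrite ltn_add2l.
Qed.

End RealAnalysis.

(** * Random variables, sub-linear expectation and capacity *)

Section SublinearExpectation.
Context d (Omega : measurableType d) (R : realType).
Variables (H : set (Omega -> R)) (E : (Omega -> R) -> \bar R).
Hypotheses (hH : rv_space H) (hE : sublinear_expectation H E).

Lemma rv_cst (c : R) : H (fun=> c).
Proof.
have := @rv_clLip _ _ _ _ hH 0 (fun _ _ => 0) (fun=> c) _ (blip_clLip (blip_cst _ c)).
by apply => -[].
Qed.

Lemma rv_lip (f : R -> R) (K : R) (X : Omega -> R) :
  (forall x y, `|f x - f y| <= K * `|x - y|) -> H X -> H (fun w => f (X w)).
Proof.
move=> fK HX.
have cf : clLip (fun x : 'rV[R]_1 => f (x 0 0)).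
  exists (`|K| + 1), 0%N; split; first by rewrite ltr_wpDl.
  move=> x y; rewrite (le_trans (fK _ _))// !expr0.
  have := coord_norm_le (x - y) 0; rewrite !mxE => h.
  have := normr_ge0 (x 0 0 - y 0 0); have := ler_norm K; have := normr_ge0 K.
  nra.
have := rv_clLip hH (X := fun=> X) (fun=> HX) cf.
by under eq_fun do rewrite mxE.
Qed.

Lemma rv_blip (f : R -> R) (X : Omega -> R) :
  blip (f : R^o -> R) -> H X -> H (fun w => f (X w)).
Proof. by move=> [K K0 fK]; apply: (rv_lip (K := K)) => x y; have [_] := fK x y. Qed.

Lemma rv_opp (X : Omega -> R) : H X -> H (fun w => - X w).
Proof.
move=> HX; have := rv_scale hH (-1) HX.
by rewrite (_ : (fun w => -1 * X w) = (fun w => - X w))//; apply/funext => w; rewrite mulN1r.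
Qed.

Lemma rv_sum n (X : nat -> Omega -> R) :
  (forall k, H (X k)) -> H (fun w => \sum_(k < n) X k w).
Proof.
move=> HX; elim: n => [|n IH].
  by under eq_fun do rewrite big_ord0; exact: rv_cst.
by under eq_fun do rewrite big_ord_recr/=; exact: (rv_add hH).
Qed.

Lemma rv_measurable_gt (X : Omega -> R) (c : R) : H X ->
  measurable [set w | c < X w].
Proof.
move=> HX; have := rv_measurable hH HX measurableT (measurable_itv `]c, +oo[).
by rewrite setTI; congr (measurable _); apply/seteqP; split=> w /=;
  rewrite in_itv/= andbT.
Qed.

Definition bdd_rv (Z : Omega -> R) : Prop :=
  H Z /\ exists K, forall w, `|Z w| <= K.

(** On bounded random variables [E] is finite, so that [ev] is [E] itself as
    a sub-linear functional with real values. *)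
Definition ev (Z : Omega -> R) : R := fine (E Z).

Lemma evE Z : bdd_rv Z -> E Z = (ev Z)%:E.
Proof.
move=> [HZ [K ZK]]; rewrite /ev fineK// fin_numE -leye_eq -leeNy_eq -!ltNge.
apply/andP; split.
  apply: (@lt_le_trans _ _ (E (fun=> - K))); first by rewrite (sle_cst hE) ltNyr.
  apply: (sle_mono hE) => //; first exact: rv_cst.
  by move=> w; have := ZK w; rewrite ler_norml => /andP[].
apply: (@le_lt_trans _ _ (E (fun=> K))); last by rewrite (sle_cst hE) ltry.
apply: (sle_mono hE) => //; first exact: rv_cst.
by move=> w; have := ZK w; rewrite ler_norml => /andP[].
Qed.

Lemma bdd_cst c : bdd_rv (fun=> c).
Proof. by split; [exact: rv_cst|exists `|c|]. Qed.

Lemma bddD Y Z : bdd_rv Y -> bdd_rv Z -> bdd_rv (fun w => Y w + Z w).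
Proof.
move=> [HY [K YK]] [HZ [L ZL]]; split; first exact: (rv_add hH).
by exists (K + L) => w; rewrite (le_trans (ler_normD _ _))// lerD.
Qed.

Lemma bddZ c Z : bdd_rv Z -> bdd_rv (fun w => c * Z w).
Proof.
move=> [HZ [K ZK]]; split; first exact: (rv_scale hH).
by exists (`|c| * K) => w; rewrite normrM ler_wpM2l.
Qed.

Lemma bddN Z : bdd_rv Z -> bdd_rv (fun w => - Z w).
Proof.
move=> [HZ [K ZK]]; split; first exact: rv_opp.
by exists K => w; rewrite normrN.
Qed.

Lemma bdd_sum n (Z : nat -> Omega -> R) :
  (forall k, (k < n)%N -> bdd_rv (Z k)) -> bdd_rv (fun w => \sum_(k < n) Z k w).
Proof.
elim: n => [|n IH] bZ.
  by under eq_fun do rewrite big_ord0; exact: bdd_cst.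
under eq_fun do rewrite big_ord_recr/=; apply: bddD; last exact: bZ.
by apply: IH => k kn; apply: bZ; rewrite ltnS ltnW.
Qed.

Lemma bdd_blip (f : R -> R) X : blip (f : R^o -> R) -> H X ->
  bdd_rv (fun w => f (X w)).
Proof.
move=> ff HX; split; first exact: rv_blip.
by case: ff => K _ fK; exists K => w; have [] := fK (X w) (X w).
Qed.

Lemma ev_cst c : ev (fun=> c) = c.
Proof. by rewrite /ev (sle_cst hE). Qed.

Lemma ev_le Y Z : bdd_rv Y -> bdd_rv Z -> (forall w, Y w <= Z w) -> ev Y <= ev Z.
Proof.
move=> bY bZ YZ; rewrite -lee_fin -!evE//.
by apply: (sle_mono hE) => //; [case: bZ|case: bY].
Qed.

Lemma evD Y Z : bdd_rv Y -> bdd_rv Z -> ev (fun w => Y w + Z w) <= ev Y + ev Z.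
Proof.
move=> bY bZ; rewrite -lee_fin EFinD -!evE//; last exact: bddD.
apply: (sle_subadd hE); [by case: bY|by case: bZ|].
by rewrite !evE// fin_num_adde_defr.
Qed.

Lemma evZ c Z : bdd_rv Z -> 0 <= c -> ev (fun w => c * Z w) = c * ev Z.
Proof.
move=> bZ c0; apply: EFin_inj; rewrite EFinM -!evE//; last exact: bddZ.
by apply: (sle_scale hE) => //; case: bZ.
Qed.

Lemma evDc Z c : bdd_rv Z -> ev (fun w => Z w + c) = ev Z + c.
Proof.
move=> bZ; apply/eqP; rewrite eq_le; apply/andP; split.
  by rewrite -{2}(ev_cst c) evD//; exact: bdd_cst.
rewrite -lerBrDr -[- c]ev_cst.
apply: le_trans (evD (bddD bZ (bdd_cst c)) (bdd_cst (- c))).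
by under [in leRHS]eq_fun do rewrite addrK.
Qed.

Lemma ev_sum n (Z : nat -> Omega -> R) : (forall k, (k < n)%N -> bdd_rv (Z k)) ->
  ev (fun w => \sum_(k < n) Z k w) <= \sum_(k < n) ev (Z k).
Proof.
elim: n => [|n IH] bZ.
  by under eq_fun do rewrite big_ord0; rewrite big_ord0 ev_cst.
under eq_fun do rewrite big_ord_recr/=; rewrite big_ord_recr/=.
have bZ' k : (k < n)%N -> bdd_rv (Z k) by move=> kn; apply: bZ; rewrite ltnS ltnW.
apply: (le_trans (evD (bdd_sum bZ') (bZ _ (ltnSn _)))).
by rewrite lerD2r IH.
Qed.

Lemma ev_dist Y Z (e : R) : bdd_rv Y -> bdd_rv Z ->
  (forall w, `|Y w - Z w| <= e) -> `|ev Y - ev Z| <= e.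
Proof.
move=> bY bZ YZ; rewrite ler_distl lerBlDr -!evDc//.
apply/andP; split.
  apply: ev_le => //; first exact: bddD bY (bdd_cst _).
  by move=> w; have := YZ w; rewrite ler_distl => /andP[]; lra.
apply: ev_le => //; first exact: bddD bZ (bdd_cst _).
by move=> w; have := YZ w; rewrite ler_distl => /andP[]; lra.
Qed.

Let V := capacity H E.

Lemma cap_le (A : set Omega) xi : H xi -> (forall w, 0 <= xi w) -> (forall w, A w -> 1 <= xi w) ->
  (V A <= E xi)%E.
Proof.
move=> Hxi xi0 xi1; apply: ereal_inf_lbound; exists xi => //; split=> // w.
by rewrite indicE; case: (boolP (w \in A)) => // /set_mem /xi1.
Qed.

Lemma cap_ge (A : set Omega) xi : H xi -> (forall w, xi w <= 1) -> (forall w, ~ A w -> xi w <= 0) ->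
  (E xi <= V A)%E.
Proof.
move=> Hxi xi1 xi0; apply: le_ereal_inf_tmp => _ [z [Hz Az] <-].
apply: (sle_mono hE) => // w; apply: le_trans (Az w); rewrite indicE.
by case: (boolP (w \in A)) => [_|/negP wA]; [exact: xi1|apply: xi0 => /mem_set].
Qed.

Lemma cap_ge0 A : (0 <= V A)%E.
Proof. by rewrite -[0%E]/(0%:E) -(sle_cst hE 0); apply: cap_ge => //; exact: rv_cst. Qed.

Lemma cap_le1 A : (V A <= 1)%E.
Proof. by rewrite -[1%E]/(1%:E) -(sle_cst hE 1); apply: cap_le => //; exact: rv_cst. Qed.

Lemma cap_fin_num A : V A \is a fin_num.
Proof. by rewrite ge0_fin_numE ?cap_ge0// (le_lt_trans (cap_le1 A))// ltry. Qed.

Lemma cap_mono (A B : set Omega) : A `<=` B -> (V A <= V B)%E.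
Proof.
move=> AB; apply: le_ereal_inf_tmp => _ [z [Hz Bz] <-].
apply: cap_le => // w; first by rewrite (le_trans _ (Bz w))// indicE.
by move=> /AB Bw; rewrite (le_trans _ (Bz w))// indicE mem_set.
Qed.

Lemma cap_set0 : V set0 = 0%E.
Proof.
apply/eqP; rewrite eq_le cap_ge0 andbT -[0%E]/(0%:E) -(sle_cst hE 0).
by apply: cap_le => //; exact: rv_cst.
Qed.

Lemma cap_setT : V setT = 1%E.
Proof.
apply/eqP; rewrite eq_le cap_le1 -[1%E]/(1%:E) -(sle_cst hE 1).
by apply: cap_ge => // [|w []//]; exact: rv_cst.
Qed.

Lemma capU A B : (V (A `|` B) <= V A + V B)%E.
Proof.
apply/lee_addgt0Pr => e e0.
have e20 : 0 < e / 2 by rewrite divr_gt0.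
have [_ [y [Hy Ay] <-] yA] := lb_ereal_inf_adherent e20 (cap_fin_num A).
have [_ [z [Hz Bz] <-] zB] := lb_ereal_inf_adherent e20 (cap_fin_num B).
have y0 w : 0 <= y w by rewrite (le_trans _ (Ay w))// indicE.
have z0 w : 0 <= z w by rewrite (le_trans _ (Bz w))// indicE.
have E0 x : H x -> (forall w, 0 <= x w) -> (0 <= E x)%E.
  by move=> Hx x0; rewrite -[0%E]/(0%:E) -(sle_cst hE 0); apply: (sle_mono hE) => //; exact: rv_cst.
have -> : (V A + V B + e%:E = (V A + (e / 2)%:E) + (V B + (e / 2)%:E))%E.
  by rewrite addeACA -EFinD -splitr.
apply: (@le_trans _ _ (E y + E z)%E); last by rewrite leeD// ltW.
apply: (@le_trans _ _ (E (fun w => y w + z w))); last first.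
  by apply: (sle_subadd hE) => //; apply: ge0_adde_def; rewrite inE E0.
apply: cap_le => [|w|w]; first exact: (rv_add hH).
  by rewrite addr_ge0.
case=> [Aw|Bw].
  by have := Ay w; rewrite indicE mem_set//= => h; have := z0 w; lra.
by have := Bz w; rewrite indicE mem_set//= => h; have := y0 w; lra.
Qed.

Lemma cap_bigU (A : nat -> set Omega) n :
  (V (\big[setU/set0]_(k < n) A k) <= \sum_(0 <= k < n) V (A k))%E.
Proof.
elim: n => [|n IH]; first by rewrite big_ord0 cap_set0 big_geq.
rewrite big_ord_recr big_nat_recr//=; apply: (le_trans (capU _ _)).
exact: leeD2r.
Qed.

Lemma cap_setC A : (1 - V (~` A) <= V A)%E.
Proof. 
by rewrite leeBlDr ?cap_fin_num// -cap_setT -(setUv A) capU.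
Qed.

Lemma continuous_countably_subadditive :
  continuous_capacity V -> countably_subadditive V.
Proof.
move=> [cb _] A mA.
pose B n := \big[setU/set0]_(k < n.+1) A k.
have mB n : measurable (B n) by exact: bigsetU_measurable.
have Bnd : nondecreasing_seq B.
  by move=> m n mn; apply/subsetPset; apply: subset_bigsetU; rewrite ltnS.
have BA : \bigcup_n B n = \bigcup_n A n by exact: bigcup_bigsetU_bigcup.
have := cb B mB Bnd; rewrite BA => cv.
have V0 n : (0 <= V (A n))%E by exact: cap_ge0.
rewrite -(cvg_lim _ cv)//; apply: lime_le; first exact: cvgP cv.
apply: nearW => n /=; apply: (le_trans (cap_bigU _ _)).
by apply: nneseries_lim_ge => k _ _.
Qed.

Lemma cap_null_bigcup (A : nat -> set Omega) : countably_subadditive V ->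
  (forall n, measurable (A n)) -> (forall n, V (A n) = 0%E) ->
  V (\bigcup_n A n) = 0%E.
Proof.
move=> sV mA A0; apply/eqP; rewrite eq_le cap_ge0 andbT.
by apply: (le_trans (sV A mA)); rewrite eseries0.
Qed.

(** The direct half of Borel-Cantelli needs only countable sub-additivity. *)
Lemma cap_Borel_Cantelli (A : nat -> set Omega) (b : nat -> R) (B : R) :
  countably_subadditive V -> (forall n, measurable (A n)) ->
  (forall n, 0 <= b n) -> (forall n, \sum_(k < n) b k <= B) ->
  (forall n, (V (A n) <= (b n)%:E)%E) ->
  V (\bigcap_n \bigcup_k A (n + k)%N) = 0%E.
Proof.
move=> sV mA b0 bB Ab.
have bs : (\sum_(0 <= k <oo) (b k)%:E < +oo)%E.
  by apply: le_lt_trans (ler_sum_nat_series b0 bB) _; rewrite ltry.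
have cv := nneseries_tail_cvg bs (fun k _ => b0 k : (0 <= (b k)%:E)%E).
apply/eqP; rewrite eq_le cap_ge0 andbT.
rewrite -(cvg_lim _ cv)//; apply: lime_ge; first exact: cvgP cv.
apply: nearW => n; apply: (@le_trans _ _ (V (\bigcup_k A (n + k)%N))).
  by apply: cap_mono => w /(_ n I).
apply: (le_trans (sV _ _)) => //.
rewrite -(@nneseries_addn _ (fun k => (b k)%:E) n) => [|i]; last by rewrite lee_fin.
by apply: lee_nneseries => k *; [exact: cap_ge0|rewrite addnC].
Qed.

End SublinearExpectation.

(** * Products along independent and negatively dependent sequences *)

Section Sequences.
Context d (Omega : measurableType d) (R : realType).
Variables (H : set (Omega -> R)) (E : (Omega -> R) -> \bar R).
Hypotheses (hH : rv_space H) (hE : sublinear_expectation H E).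
Variable X : nat -> Omega -> R.
Hypothesis HX : forall n, H (X n).

Local Notation ev := (ev E).

Definition prefix_fun (n : nat) (Z : Omega -> R) : Prop :=
  exists2 phi : 'rV[R]_n -> R, blip phi & Z = phi \o prefix_vec X n.

Lemma prefix_fun_bdd n Z : prefix_fun n Z -> bdd_rv H Z.
Proof.
move=> [phi bphi ->]; split.
  exact: (rv_clLip hH (X := fun i : 'I_n => X i) (fun i => HX i) (blip_clLip bphi)).
by case: bphi => K _ hK; exists K => w; have [] := hK (prefix_vec X n w) 0.
Qed.

Lemma prefix_fun_cst n c : prefix_fun n (fun=> c).
Proof. by exists (fun=> c) => //; exact: blip_cst. Qed.

Lemma prefix_funD n Y Z : prefix_fun n Y -> prefix_fun n Z ->
  prefix_fun n (fun w => Y w + Z w).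
Proof.
move=> [f bf ->] [g bg ->].
by exists (fun x => f x + g x) => //; exact: blipD.
Qed.

Lemma prefix_funM n Y Z : prefix_fun n Y -> prefix_fun n Z ->
  prefix_fun n (fun w => Y w * Z w).
Proof.
move=> [f bf ->] [g bg ->].
by exists (fun x => f x * g x) => //; exact: blipM.
Qed.

Lemma prefix_fun_widen m n Z : (m <= n)%N -> prefix_fun m Z -> prefix_fun n Z.
Proof.
move=> mn [f bf ->].
exists (fun x : 'rV[R]_n => f (\row_(j < m) x 0 (widen_ord mn j))).
  exact: blip_prefix.
by apply/funext => w /=; congr f; apply/rowP => j; rewrite !mxE.
Qed.

Lemma prefix_fun_coord n k (f : R -> R) : (k < n)%N -> blip (f : R^o -> R) ->
  prefix_fun n (fun w => f (X k w)).
Proof.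
move=> kn bf; exists (fun x => f (x 0 (Ordinal kn))); first exact: (blip_coord _ bf).
by apply/funext => w /=; rewrite mxE.
Qed.

Lemma prefix_fun_prod (f : nat -> R -> R) m l :
  (forall k, blip (f k : R^o -> R)) ->
  prefix_fun (m + l) (fun w => \prod_(j < l) f (m + j)%N (X (m + j)%N w)).
Proof.
move=> bf; elim: l => [|l IH].
  by under eq_fun do rewrite big_ord0; exact: prefix_fun_cst.
under eq_fun do rewrite big_ord_recr/=; apply: prefix_funM.
  by apply: prefix_fun_widen IH; rewrite leq_add2l.
by apply: prefix_fun_coord => //; rewrite ltn_add2l.
Qed.

Lemma ev_identically_distributed (f : R -> R) n : identically_distributed E X ->
  blip (f : R^o -> R) -> ev (fun w => f (X n w)) = ev (fun w => f (X 0%N w)).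
Proof.
move=> idX bf; rewrite /ev (idX n f (blip_clLip bf))//.
  by rewrite (evE hH hE (bdd_blip hH bf (HX n))).
by rewrite (evE hH hE (bdd_blip hH bf (HX 0))).
Qed.

Section Independence.
Hypotheses (indX : independent_seq H E X) (idX : identically_distributed E X).

(** The only form in which independence is used: a function affine in
    [f (X n)], with a non-negative slope, may have [f (X n)] replaced by its
    expectation. Positivity of the slope matters because a sub-linear
    expectation commutes only with non-negative factors. The conditional
    expectation [psi] is again affine in [A] and [B], and the conditional
    expectation of the absolute value is bounded Lipschitz in the past, so both
    belong to [H] as the definition of independence requires. *)
Lemma ev_affine_independent n (A B : Omega -> R) (f : R -> R) :
  prefix_fun n A -> prefix_fun n B -> (forall w, 0 <= B w) ->
  blip (f : R^o -> R) ->
  ev (fun w => A w + B w * f (X n w)) =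
  ev (fun w => A w + B w * ev (fun w' => f (X 0%N w'))).
Proof.
move=> pA pB B0 bf.
have bfX m : bdd_rv H (fun w => f (X m w)) by exact: (bdd_blip hH bf).
have evAB a b m : 0 <= b ->
    ev (fun w => a + b * f (X m w)) = a + b * ev (fun w => f (X 0%N w)).
  move=> b0; under eq_fun do rewrite addrC.
  rewrite (evDc hH hE)//; last exact: bddZ.
  by rewrite (evZ hH hE)// (ev_identically_distributed m idX bf) addrC.
case: n pA pB => [|n] pA pB.
  (* with an empty past, A and B are constants; the absolute value makes the
     constant slope non-negative without using a point of Omega *)
  have cst0 Z : prefix_fun 0 Z -> exists c, Z = fun=> c.
    move=> [phi _ ->]; exists (phi 0); apply/funext => w /=; congr phi.
    by apply/rowP => -[].
  have [a Aa] := cst0 _ pA; have [b Bb] := cst0 _ pB.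
  have -> : B = fun=> `|b|.
    by apply/funext => w; rewrite Bb ger0_norm// -[b]/((fun=> b) w) -Bb.
  by rewrite Aa evAB// (ev_cst hE).
have [a ba Aa] := pA; have [b bb Bb] := pB.
pose phi (z : 'rV[R]_n.+1 * 'rV[R]_1) : R := a z.1 + b z.1 * f (z.2 0 0).
have bphi : blip phi.
  have fst_lip (x y : 'rV[R]_n.+1 * 'rV[R]_1) : `|x.1 - y.1| <= `|x - y|.
    by rewrite [leRHS]prod_normE/= le_max lexx.
  have snd_lip (x y : 'rV[R]_n.+1 * 'rV[R]_1) : `|x.2 - y.2| <= `|x - y|.
    by rewrite [leRHS]prod_normE/= le_max lexx orbT.
  apply: blipD; first exact: (blip_comp fst_lip ba).
  apply: blipM; first exact: (blip_comp fst_lip bb).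
  exact: (blip_comp snd_lip (blip_coord 0 bf)).
have [Ka Ka0 hKa] := ba; have [Kb Kb0 hKb] := bb; have [Kf Kf0 hKf] := bf.
have bsect x : blip (fun y : R^o => a x + b x * f y).
  by apply: blipD; [exact: blip_cst|apply: blipM => //; exact: blip_cst].
have Yw w : singleton_vec (X n.+1) w 0 0 = X n.+1 w by rewrite mxE.
have bphiw x : bdd_rv H (fun w => phi (x, singleton_vec (X n.+1) w)).
  rewrite /phi/=; under eq_fun do rewrite Yw.
  exact: (bdd_blip hH (f := fun y => a x + b x * f y)).
have babsw x : bdd_rv H (fun w => `|phi (x, singleton_vec (X n.+1) w)|).
  rewrite /phi/=; under eq_fun do rewrite Yw.
  exact: (bdd_blip hH (f := fun y => `|a x + b x * f y|) (blip_norm _)).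
have rv_vec (g : 'rV[R]_n.+1 -> R) : blip g ->
    bdd_rv H (fun w => g (prefix_vec X n.+1 w)).
  by move=> bg; apply: (@prefix_fun_bdd n.+1); exists g.
pose psi x := fine (E (fun w => phi (x, singleton_vec (X n.+1) w))).
have psiE w : psi (prefix_vec X n.+1 w) = A w + B w * ev (fun w' => f (X 0%N w')).
  rewrite /psi /phi/=; under eq_fun do rewrite Yw.
  rewrite -[fine _]/(ev _) evAB ?Aa ?Bb//.
  by have := B0 w; rewrite Bb.
pose absphi x := fine (E (fun w => `|phi (x, singleton_vec (X n.+1) w)|)).
have babs : blip absphi.
  have [K K0 hK] := bphi; exists K => // x y; split.
    have -> : absphi x = absphi x - ev (fun=> 0) by rewrite (ev_cst hE) subr0.
    apply: (ev_dist hH hE (babsw x) (bdd_cst hH 0)) => w.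
    rewrite subr0 normr_id; have [] // := hK (x, singleton_vec (X n.+1) w) 0.
  apply: (ev_dist hH hE (babsw x) (babsw y)) => w.
  apply: (le_trans (ler_dist_dist _ _)).
  have [_] := hK (x, singleton_vec (X n.+1) w) (y, singleton_vec (X n.+1) w).
  move/le_trans; apply; rewrite ler_wpM2l// prod_normE/= subrr normr0.
  by rewrite ge_max lexx/=.
have pAB : prefix_fun n.+1 (fun w => A w + B w * ev (fun w' => f (X 0%N w'))).
  by apply: prefix_funD => //; apply: prefix_funM => //; exact: prefix_fun_cst.
have := indX (blip_clLip bphi).
rewrite /= => /(_ _ _ _ _)/(congr1 fine).
have -> : (fun w => phi (prefix_vec X n.+1 w, singleton_vec (X n.+1) w)) =
    fun w => A w + B w * f (X n.+1 w).
  by apply/funext => w; rewrite /phi/= Yw Aa Bb.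
have -> : (fun w => fine (E (fun w0 => phi (prefix_vec X n.+1 w, singleton_vec (X n.+1) w0)))) =
    fun w => A w + B w * ev (fun w' => f (X 0%N w')).
  by apply/funext => w; exact: psiE.
apply.
- by move=> x; rewrite (evE hH hE)// ltry.
- by have [] := rv_vec _ babs.
- by have [] := prefix_fun_bdd pAB.
- have [Hb _] := rv_vec _ (blip_norm babs).
  by rewrite (evE hH hE (rv_vec _ (blip_norm babs))) ltry.
Qed.

(** Integrating out the last factor of a window, one at a time. The sign [s]
    distinguishes the upper expectation of a product ([s = 1]) from the lower
    one ([s = -1]), as [r k] is [ev (f k)] or [- ev (- f k)] accordingly; the
    summand [A] allows sums of products over consecutive windows. *)
Lemma ev_prod_independent (s : R) (f : nat -> R -> R) (r : nat -> R) n l A B :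
  prefix_fun n A -> prefix_fun n B -> (forall w, 0 <= B w) ->
  (forall k, blip (f k : R^o -> R)) -> (forall k x, 0 <= f k x) ->
  (forall k, 0 <= r k) ->
  (forall k, ev (fun w => s * f k (X 0%N w)) = s * r k) ->
  ev (fun w => A w + s * (B w * \prod_(j < l) f (n + j)%N (X (n + j)%N w))) =
  ev (fun w => A w + s * (B w * \prod_(j < l) r (n + j)%N)).
Proof.
move=> pA + + bf f0 r0 fr; elim: l B => [|l IH] B pB B0.
  by congr ev; apply/funext => w; rewrite !big_ord0.
pose P w := \prod_(j < l) f (n + j)%N (X (n + j)%N w).
have pP : prefix_fun (n + l) P by exact: prefix_fun_prod.
transitivity (ev (fun w => A w + B w * P w * (s * f (n + l)%N (X (n + l)%N w)))).
  congr ev; apply/funext => w; rewrite big_ord_recr/= -/(P w); ring.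
rewrite (@ev_affine_independent (n + l)%N A (fun w => B w * P w) (fun x => s * f (n + l)%N x)).
- rewrite fr.
  transitivity (ev (fun w => A w + s * (B w * r (n + l)%N * P w))).
    by congr ev; apply/funext => w; ring.
  rewrite IH.
  + congr ev; apply/funext => w; rewrite big_ord_recr/=; ring.
  + by apply: prefix_funM => //; exact: prefix_fun_cst.
  + by move=> w; rewrite mulr_ge0.
- by apply: prefix_fun_widen pA; exact: leq_addr.
- apply: prefix_funM => //; apply: prefix_fun_widen pB; exact: leq_addr.
- by move=> w; rewrite mulr_ge0// prodr_ge0.
- by apply: blipM => //; exact: blip_cst.
Qed.

End Independence.

Lemma ev_prod_negatively_dependent (f : R -> R) n :
  negatively_dependent_seq E X -> identically_distributed E X ->
  blip (f : R^o -> R) -> (forall x, 0 <= f x) ->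
  {homo f : x y / x <= y} \/ {homo f : x y /~ x <= y} ->
  ev (fun w => \prod_(k < n) f (X k w)) <= ev (fun w => f (X 0%N w)) ^+ n.
Proof.
move=> ndX idX bf f0 fmono.
have bfX m : bdd_rv H (fun w => f (X m w)) by exact: (bdd_blip hH bf).
case: n => [|n]; first by under eq_fun do rewrite big_ord0; rewrite (ev_cst hE).
elim: n => [|n IH]; first by under eq_fun do rewrite big_ord1.
pose P w := \prod_(k < n.+1) f (X k w).
pose phi1 (x : 'rV[R]_n.+1) := \prod_(k < n.+1) f (x 0 k).
pose phi2 (x : 'rV[R]_1) := f (x 0 0).
have phi1E w : phi1 (prefix_vec X n.+1 w) = P w.
  by apply: eq_bigr => k _; rewrite mxE.
have phi2E w : phi2 (singleton_vec (X n.+1) w) = f (X n.+1 w).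
  by rewrite /phi2 mxE.
have bphi2 : blip phi2 by exact: blip_coord.
have bphi1 : blip phi1 by apply: blip_prod => k; exact: blip_coord.
have bP : bdd_rv H P.
  by apply: (@prefix_fun_bdd n.+1); exists phi1 => //; apply/funext => w /=.
have P0 w : 0 <= P w by exact: prodr_ge0.
have bPf : bdd_rv H (fun w => P w * f (X n.+1 w)).
  have -> : (fun w => P w * f (X n.+1 w)) = fun w => \prod_(k < n.+2) f (X k w).
    by apply/funext => w; rewrite [RHS]big_ord_recr.
  exact: (prefix_fun_bdd (@prefix_fun_prod (fun _ => f) 0 n.+2 (fun _ => bf))).
have ndn := ndX n _ _ (blip_clLip bphi1) (blip_clLip bphi2).
have {ndn} : (E (fun w => P w * f (X n.+1 w))%R <=
    E P * E (fun w => f (X n.+1 w)))%E.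
  move: ndn; have -> : (fun w => phi2 (singleton_vec (X n.+1) w)) =
      fun w => f (X n.+1 w) by apply/funext.
  have -> : (fun w => phi1 (prefix_vec X n.+1 w)) = P by apply/funext.
  rewrite (_ : (fun w => (phi1 _ * phi2 _)%R) = fun w => P w * f (X n.+1 w)); last first.
    by apply/funext => w; rewrite phi1E phi2E.
  rewrite (_ : (fun w => `|phi1 _ * phi2 _|) = fun w => P w * f (X n.+1 w)); last first.
    by apply/funext => w; rewrite phi1E phi2E ger0_norm// mulr_ge0.
  rewrite (_ : (fun w => `|phi1 _|) = P); last first.
    by apply/funext => w; rewrite phi1E ger0_norm.
  rewrite (_ : (fun w => `|phi2 _|) = fun w => f (X n.+1 w)); last first.
    by apply/funext => w; rewrite phi2E ger0_norm.
  rewrite !(evE hH hE)//; apply; rewrite ?ltry//.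
  - by move=> w; rewrite phi1E.
  - rewrite lee_fin -(ev_cst hE 0); apply: (ev_le hH hE) => //; exact: bdd_cst.
  - case: fmono => fm; [left|right]; split=> x y xy; try exact: fm.
      by apply: ler_prod => k _; rewrite f0/= fm.
    by apply: ler_prod => k _; rewrite f0/= fm.
rewrite !(evE hH hE)// -EFinM lee_fin (ev_identically_distributed n.+1 idX bf).
have -> : (fun w => \prod_(k < n.+2) f (X k w)) = fun w => P w * f (X n.+1 w).
  by apply/funext => w; rewrite big_ord_recr.
move/le_trans; apply; rewrite exprSr ler_wpM2r//.
by rewrite -(ev_cst hE 0); apply: (ev_le hH hE) => //; exact: bdd_cst.
Qed.

End Sequences.

(** * Upper half of the strong law *)

Section Cutoff.
Variable R : realType.

(** A Lipschitz replacement for the indicator of [b <= `|x|], squeezed between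
    it and the indicator of [b / 2 <= `|x|]. *)
Definition cutoff (b x : R) : R := clamp 0 1 (2 / b * `|x| - 1).

Lemma cutoff_ge0 b x : 0 <= cutoff b x.
Proof. exact: clamp_ge. Qed.

Lemma cutoff_le1 b x : cutoff b x <= 1.
Proof. exact: clamp_le. Qed.

Lemma cutoff1 b x : 0 < b -> b <= `|x| -> cutoff b x = 1.
Proof.
move=> b0 bx; apply/eqP; rewrite eq_le cutoff_le1/= /cutoff /clamp le_min lexx andbT.
rewrite le_max; apply/orP; left.
have : 1 <= `|x| / b by rewrite ler_pdivlMr// mul1r.
lra.
Qed.

Lemma cutoff0 b x : 0 < b -> `|x| < b / 2 -> cutoff b x = 0.
Proof.
move=> b0 bx; apply/eqP; rewrite eq_le cutoff_ge0 andbT /cutoff /clamp.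
rewrite ge_min ge_max lexx andbT; apply/orP; left.
have : `|x| / b <= 1 / 2 by rewrite ler_pdivrMr//; lra.
lra.
Qed.

Lemma blip_cutoff b : blip (cutoff b : R^o -> R).
Proof.
apply: (@blip_of_lip _ _ 1 `|2 / b|) => [x|x y].
  by rewrite ger0_norm ?cutoff_ge0// cutoff_le1.
rewrite (le_trans (clamp_lip _ _ _ _))//.
rewrite opprB addrA subrK -mulrBr normrM ler_wpM2l//.
exact: ler_dist_dist.
Qed.

Lemma sum_halving_bounded (s t : nat -> R) (T : R) :
  (forall j, 0 <= s j) -> (forall j, s j.+1 <= s j / 2 + t j) ->
  (forall J, \sum_(j < J) t j <= T) ->
  forall J, \sum_(j < J) s j <= 2 * (s 0%N + T).
Proof.
move=> s0 st tT; elim=> [|J IH].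
  by rewrite big_ord0 mulr_ge0// addr_ge0//; have := tT 0%N; rewrite big_ord0.
rewrite big_ord_recl/=.
have : \sum_(j < J) s j.+1 <= (\sum_(j < J) s j) / 2 + T.
  rewrite (le_trans _ (lerD (lexx _) (tT J)))// mulr_suml -big_split/=.
  by apply: ler_sum => j _; exact: st.
by under eq_bigr do rewrite /bump/= add1n; lra.
Qed.

Lemma sum_inv2_bounded J : \sum_(j < J) (2 ^+ j)^-1 <= 2 :> R.
Proof.
have := @sum_halving_bounded (fun j => (2 ^+ j)^-1) (fun=> 0) 0.
rewrite expr0 invr1 addr0 mulr1; apply => [j|j|K].
- by rewrite invr_ge0 exprn_ge0.
- by rewrite addr0 exprSr invfM.
- by rewrite big1.
Qed.

End Cutoff.

Section UpperLaw.
Context d (Omega : measurableType d) (R : realType).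
Variables (H : set (Omega -> R)) (E : (Omega -> R) -> \bar R).
Hypotheses (hH : rv_space H) (hE : sublinear_expectation H E).
Let V := capacity H E.
Local Notation ev := (ev E).

(** If [E Y] were [-oo] then, [E (- Y)] being bounded above, sub-additivity
    would give [0 = E (Y - Y) <= -oo]. *)
Lemma fin_num_dominated (Y Z : Omega -> R) : H Y -> H Z ->
  (forall w, `|Y w| <= Z w) -> (E Z < +oo)%E -> E Y \is a fin_num.
Proof.
move=> HY HZ YZ Zoo; have HN := rv_opp hH HY.
have Yoo : (E Y < +oo)%E.
  apply: le_lt_trans Zoo; apply: (sle_mono hE) => // w.
  exact: le_trans (ler_norm _) (YZ w).
have Noo : (E (fun w => - Y w)%R < +oo)%E.
  apply: le_lt_trans Zoo; apply: (sle_mono hE) => // w.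
  by rewrite (le_trans _ (YZ w))// -normrN ler_norm.
rewrite fin_numElt Yoo andbT ltNye; apply/negP => /eqP YNy.
have := sle_subadd hE HY HN; rewrite YNy (_ : (fun w => _ + _) = fun=> 0).
  by rewrite (sle_cst hE); case: (E (fun w => - Y w)%R) Noo => // [r|] _ /(_ isT).
by apply/funext => w; rewrite subrr.
Qed.

Lemma rv_excess (c : R) (Y : Omega -> R) : H Y ->
  H (fun w => Num.max (`|Y w| - c) 0).
Proof.
apply: (rv_lip hH (f := fun x => Num.max (`|x| - c) 0) (K := 1)) => x y.
rewrite mul1r; have := ler_dist_dist x y; rewrite !ler_norml => /andP[h1 h2].
rewrite /Order.max; case: (ltP (`|x| - c) 0) => h3; case: (ltP (`|y| - c) 0) => h4;
  have := normr_ge0 (x - y); move=> h5; apply/andP; split; lra.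
Qed.

(** The shift by [c] makes truncation from below costless: the truncated
    variable exceeds [Y + c] by at most the part of [|Y|] above [c]. *)
Lemma ev_clamp_shift_le (b c : R) (Y : Omega -> R) : H Y ->
  E Y \is a fin_num ->
  E (fun w => Num.max (`|Y w| - c) 0) \is a fin_num ->
  ev (fun w => clamp 0 b (Y w + c)) <=
  fine (E Y) + c + fine (E (fun w => Num.max (`|Y w| - c) 0)).
Proof.
move=> HY fY; set T : Omega -> R := fun w => Num.max (`|Y w| - c) 0 => fT.
have HT : H T by exact: rv_excess.
have bW : bdd_rv H (fun w => clamp 0 b (Y w + c)).
  exact: (bdd_blip hH (blip_clamp_shift 0 b c)).
have HTc : H (fun w => T w + c) by apply: (rv_add hH) => //; exact: rv_cst.
rewrite -lee_fin -(evE hH hE bW).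
apply: (@le_trans _ _ (E (fun w => Y w + (T w + c)))).
  apply: (sle_mono hE) => [||w]; [exact: (rv_add hH)|by case: bW|].
  rewrite /clamp /T; apply: (@le_trans _ _ (Num.max (Y w + c) 0)).
    by rewrite ge_min lexx.
  have := ler_norm (- Y w); rewrite normrN => h1.
  rewrite ge_max; apply/andP; split.
    have : 0 <= Num.max (`|Y w| - c) 0 by rewrite le_max lexx orbT.
    lra.
  have : `|Y w| - c <= Num.max (`|Y w| - c) 0 by rewrite le_max lexx.
  lra.
have Tc : (E (fun w => (T w + c)%R) <= E T + c%:E)%E.
  rewrite -(sle_cst hE c); apply: (sle_subadd hE) => //; first exact: rv_cst.
  exact: fin_num_adde_defr.
apply: (le_trans (sle_subadd hE HY HTc _)).
  exact: fin_num_adde_defr.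
apply: (le_trans (leeD (lexx _) Tc)).
by rewrite -{1}(fineK fY) -{1}(fineK fT) -!EFinD lee_fin; lra.
Qed.

Lemma excess_small (Y : Omega -> R) (eps : R) :
  E (fun w => Num.max (`|Y w| - c) 0) @[c --> +oo%R] --> 0%E ->
  0 < eps -> exists2 c, 0 <= c &
  E (fun w => Num.max (`|Y w| - c) 0) \is a fin_num /\
  fine (E (fun w => Num.max (`|Y w| - c) 0)) <= eps.
Proof.
move=> /fine_cvgP[ffin /cvgrPdist_le cve] /cve{}cve.
near (pinfty_nbhs R) => c; exists c; first by near: c; exact: nbhs_pinfty_ge.
split; first by near: c.
have := near cve c; rewrite sub0r normrN => h.
by rewrite (le_trans (ler_norm _))// h.
Unshelve. all: by end_near. Qed.

Lemma fin_num_of_excess (Y : Omega -> R) : H Y ->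
  E (fun w => Num.max (`|Y w| - c) 0) @[c --> +oo%R] --> 0%E ->
  E Y \is a fin_num.
Proof.
move=> HY tailY; have [c c0 [fT _]] := excess_small tailY (@ltr01 R).
apply: (@fin_num_dominated _ (fun w => Num.max (`|Y w| - c) 0 + c)) => //.
- by apply: (rv_add hH); [exact: rv_excess|exact: rv_cst].
- by move=> w; rewrite -lerBlDr le_max lexx.
apply: (@le_lt_trans _ _ (E (fun w => Num.max (`|Y w| - c)%R 0%R) + c%:E)%E).
  rewrite -(sle_cst hE c); apply: (sle_subadd hE); [exact: rv_excess|exact: rv_cst|].
  exact: fin_num_adde_defr.
by rewrite -(fineK fT) -EFinD ltry.
Qed.

Variable Y : nat -> Omega -> R.
Hypothesis HY : forall n, H (Y n).
Hypothesis idY : forall (f : R -> R) n, blip (f : R^o -> R) ->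
  ev (fun w => f (Y n w)) = ev (fun w => f (Y 0%N w)).
Hypothesis prodY : forall (f : R -> R) n, blip (f : R^o -> R) ->
  (forall x, 0 <= f x) -> {homo f : x y / x <= y} ->
  ev (fun w => \prod_(k < n) f (Y k w)) <= ev (fun w => f (Y 0%N w)) ^+ n.

Let bY (f : R -> R) k : blip (f : R^o -> R) -> bdd_rv H (fun w => f (Y k w)).
Proof. by move=> bf; exact: (bdd_blip hH bf). Qed.

Section Estimate.
Variable c : R.
Hypothesis c0 : 0 <= c.

Definition trunc (b x : R) := clamp 0 b (x + c).

Lemma blip_trunc b : blip (trunc b : R^o -> R).
Proof. exact: blip_clamp_shift. Qed.

(** Bounds the capacity of [b <= Y + c]: either [b / 2 <= |Y|], or
    [b <= 2 * c], in which case the second summand is at least 1. *)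
Definition excess_mean b := ev (fun w => cutoff (b / 2) (Y 0%N w)) + 4 * c ^+ 2 / b ^+ 2.

(** The summand 1 only keeps the second moment positive. *)
Definition second_moment b := 1 + ev (fun w => trunc b (Y 0%N w) ^+ 2).

Lemma blip_trunc2 b : blip (fun x : R^o => trunc b x ^+ 2).
Proof. by apply: blipM; exact: blip_trunc. Qed.

Lemma second_moment_ge1 b : 1 <= second_moment b.
Proof.
rewrite lerDl -(ev_cst hE 0); apply: (ev_le hH hE) => [||w].
- exact: bdd_cst.
- exact: (bY _ (blip_trunc2 b)).
- exact: sqr_ge0.
Qed.

Lemma excess_mean_ge0 b : 0 <= excess_mean b.
Proof.
rewrite addr_ge0//; last by rewrite divr_ge0 ?sqr_ge0// mulr_ge0 ?sqr_ge0.
rewrite -(ev_cst hE 0); apply: (ev_le hH hE) => [||w].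
- exact: bdd_cst.
- exact: (bY _ (blip_cutoff _)).
- exact: cutoff_ge0.
Qed.

Lemma excess_indicator b x : 0 < b -> b <= x + c ->
  1 <= cutoff (b / 2) x + 4 * c ^+ 2 / b ^+ 2.
Proof.
move=> b0 bx; have [h|h] := leP (b / 2) x.
  rewrite cutoff1 ?divr_gt0//; last by rewrite (le_trans h)// ler_norm.
  by rewrite lerDl divr_ge0 ?sqr_ge0// mulr_ge0 ?sqr_ge0.
have h2 : b <= 2 * c by lra.
rewrite -[leLHS]add0r lerD ?cutoff_ge0// ler_pdivlMr ?exprn_gt0// mul1r.
nra.
Qed.

Lemma second_moment_rec b : 0 < b ->
  second_moment (2 * b) <= second_moment b + 4 * b ^+ 2 * excess_mean b.
Proof.
move=> b0.
rewrite -addrA lerD2l /excess_mean mulrDr addrA.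
have b1 := bY 0 (blip_trunc2 b).
have b2 := bY 0 (blip_cutoff (b / 2)).
have b3 := bY 0 (blip_trunc2 (2 * b)).
have b4 := bddZ hH (4 * b ^+ 2) b2.
have b20 : 0 <= 4 * b ^+ 2 by rewrite mulr_ge0// sqr_ge0.
rewrite -(evZ hH hE)//.
apply: le_trans (lerD (evD hH hE b1 b4) (lexx _)).
rewrite -(evDc hH hE _ (bddD hH b1 b4)).
apply: (ev_le hH hE) => // [|w].
  by apply: bddD => //; [exact: (bddD hH b1 b4)|exact: bdd_cst].
rewrite -addrA -mulrDr.
have [h|h] := leP b (Y 0%N w + c).
  have h1 := excess_indicator b0 h.
  have t0 : 0 <= trunc (2 * b) (Y 0%N w) by apply: clamp_ge; lra.
  have t1 : trunc (2 * b) (Y 0%N w) <= 2 * b by exact: clamp_le.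
  have := sqr_ge0 (trunc b (Y 0%N w)).
  set e := cutoff _ _ + _ in h1 *; nra.
have -> : trunc (2 * b) (Y 0%N w) = trunc b (Y 0%N w).
  by rewrite /trunc /clamp !(min_idPl _)// ge_max; apply/andP; split; lra.
rewrite lerDl mulr_ge0// addr_ge0 ?cutoff_ge0//.
by rewrite divr_ge0 ?sqr_ge0// mulr_ge0 ?sqr_ge0.
Qed.

(** A Fuk-Nagaev bound. Outside the event that some [Y k + c] exceeds [b] the
    sum equals the sum [S] of the variables truncated at [b], and the exponential
    Markov inequality for [expR (l * S)] needs only the product bound for the
    non-decreasing function [x => expR (l * trunc b x)]. Optimising [l] gives
    the rate [n * second_moment b / b ^+ 2]; the error term [n%:R^-1] per factor
    produces the constant [expR 1]. *)
Lemma cap_positive_sum_le (m b : R) (n : nat) : (0 < n)%N -> 0 < b -> 0 <= m ->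
  ev (fun w => trunc b (Y 0%N w)) <= m ->
  (V [set w | (n%:R * m + b < \sum_(k < n) Num.max (Y k w + c) 0)%R] <=
   (n%:R * excess_mean b + expR 1 * (n%:R * second_moment b / b ^+ 2))%:E)%E.
Proof.
move=> n0 b0 m0 Wm.
set v := second_moment b; have v1 : 1 <= v := second_moment_ge1 b.
set q := n%:R * v / b ^+ 2.
have nR0 : 0 < n%:R :> R by rewrite ltr0n.
have v0 : 0 < v by lra.
have b20 : 0 < b ^+ 2 by rewrite exprn_gt0.
have q0 : 0 < q by rewrite divr_gt0// mulr_gt0.
have p0 := excess_mean_ge0 b.
have e1 : 1 <= expR 1 :> R by have := expR_ge1Dx (1 : R); lra.
(* for 1 <= q the bound exceeds 1 *)
have [q1|q1] := leP 1 q.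
  apply: (le_trans (cap_le1 hH hE _)); rewrite lee_fin.
  have : 0 <= n%:R * excess_mean b by rewrite mulr_ge0.
  nra.
pose L := - ln q.
have L0 : 0 < L by rewrite oppr_gt0 ln_lt0// q0 q1.
have eL : expR L = q^-1 by rewrite expRN lnK.
pose l := L / b.
have l0 : 0 < l by rewrite divr_gt0.
pose f x := expR (l * trunc b x).
have bf : blip (f : R^o -> R).
  by apply: blip_expR_comp; apply: blipM; [exact: blip_cst|exact: blip_trunc].
have W0 x : 0 <= trunc b x by apply: clamp_ge; exact: ltW.
have Wb x : trunc b x <= b by exact: clamp_le.
have fle x : f x <= 1 + l * trunc b x + (n%:R * v)^-1 * trunc b x ^+ 2.
  rewrite /f (le_trans (expR_quadratic_bound _ L0 _))//.
  - by rewrite mulr_ge0// ltW.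
  - by rewrite /l -mulrA ler_piMr ?(ltW L0)// mulrC ler_pdivrMr// mul1r.
  rewrite lerD2l eL /l /q le_eqVlt; apply/orP; left; apply/eqP.
  by field; rewrite !gt_eqF.
have evf : ev (fun w => f (Y 0%N w)) <= 1 + l * m + n%:R^-1.
  have c1 := bY 0 (blip_trunc b); have c2 := bY 0 (blip_trunc2 b).
  have c3 := bddZ hH l c1; have c4 := bddZ hH (n%:R * v)^-1 c2.
  apply: (@le_trans _ _ (ev (fun w => l * trunc b (Y 0%N w) +
      (n%:R * v)^-1 * trunc b (Y 0%N w) ^+ 2 + 1))).
    apply: (ev_le hH hE) => [||w]; first exact: (bY 0 bf).
      by apply: bddD => //; [exact: (bddD hH c3 c4)|exact: bdd_cst].
    by rewrite (le_trans (fle _))//; lra.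
  rewrite (evDc hH hE _ (bddD hH c3 c4)).
  rewrite -[leRHS]addrA [leRHS]addrC lerD2r.
  apply: (le_trans (evD hH hE c3 c4)).
  rewrite !(evZ hH hE)// ?(ltW l0)//; last by rewrite invr_ge0 ltW// mulr_gt0.
  apply: lerD; first by apply: ler_wpM2l => //; exact: ltW.
  rewrite invfM -mulrA ler_piMr ?invr_ge0 ?(ltW nR0)// mulrC ler_pdivrMr// mul1r.
  by rewrite /v /second_moment; lra.
have evfn : ev (fun w => f (Y 0%N w)) ^+ n <= expR (n%:R * (l * m) + 1).
  have ev0 : 0 <= ev (fun w => f (Y 0%N w)).
    rewrite -(ev_cst hE 0); apply: (ev_le hH hE) => [||w].
    - exact: bdd_cst.
    - exact: (bY 0 bf).
    - exact: expR_ge0.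
  have := expR_ge1Dx (l * m + n%:R^-1) => h.
  apply: (@le_trans _ _ (expR (l * m + n%:R^-1) ^+ n)).
    by rewrite lerXn2r ?nnegrE ?expR_ge0// (le_trans evf)//; lra.
  rewrite -expRM_natr mulrDl mulVf ?gt_eqF// (mulrC n%:R)//.
pose K := expR (- (l * (n%:R * m + b))).
pose xi w := \sum_(k < n) (cutoff (b / 2) (Y k w) + 4 * c ^+ 2 / b ^+ 2) +
  K * \prod_(k < n) f (Y k w).
have bcut k : bdd_rv H (fun w => cutoff (b / 2) (Y k w) + 4 * c ^+ 2 / b ^+ 2).
  exact: (bddD hH (bY k (blip_cutoff (b / 2))) (bdd_cst hH _)).
have bprod : bdd_rv H (fun w => \prod_(k < n) f (Y k w)).
  exact: (prefix_fun_bdd hH HY (@prefix_fun_prod _ _ _ Y (fun _ => f) 0 n (fun _ => bf))).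
have bsum : bdd_rv H (fun w => \sum_(k < n) (cutoff (b / 2) (Y k w) + 4 * c ^+ 2 / b ^+ 2)).
  exact: (bdd_sum hH (Z := fun k w => cutoff (b / 2) (Y k w) + 4 * c ^+ 2 / b ^+ 2)).
have bxi : bdd_rv H xi by exact: (bddD hH bsum (bddZ hH K bprod)).
have K0 : 0 < K by exact: expR_gt0.
have term0 k w : 0 <= cutoff (b / 2) (Y k w) + 4 * c ^+ 2 / b ^+ 2.
  by rewrite addr_ge0 ?cutoff_ge0// divr_ge0 ?sqr_ge0// mulr_ge0 ?sqr_ge0.
have prod0 w : 0 <= \prod_(k < n) f (Y k w).
  by apply: prodr_ge0 => k _; exact: expR_ge0.
apply: (@le_trans _ _ (E xi)).
  apply: cap_le => [|w|w /= Sw]; first by case: bxi.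
    by rewrite addr_ge0 ?sumr_ge0// mulr_ge0// ltW.
  have [[k kb]|nob] := pselect (exists k : 'I_n, b <= Y k w + c).
    rewrite /xi (bigD1 k)//= -addrA.
    have := excess_indicator b0 kb.
    have : 0 <= \sum_(i < n | i != k) (cutoff (b / 2) (Y i w) + 4 * c ^+ 2 / b ^+ 2).
      by apply: sumr_ge0 => i _; exact: term0.
    have : 0 <= K * \prod_(k < n) f (Y k w) by rewrite mulr_ge0// ltW.
    lra.
  have -> : xi w = \sum_(k < n) (cutoff (b / 2) (Y k w) + 4 * c ^+ 2 / b ^+ 2) +
      K * expR (l * \sum_(k < n) trunc b (Y k w)).
    by rewrite /xi mulr_sumr expR_sum.
  rewrite -[leLHS]add0r; apply: lerD; first by apply: sumr_ge0 => k _; exact: term0.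
  rewrite -expRD -[leLHS]expR0 ler_expR [leRHS]addrC subr_ge0 ler_wpM2l ?(ltW l0)//.
  apply: (le_trans (ltW Sw)); apply: ler_sum => k _.
  rewrite /trunc /clamp (min_idPl _)// ge_max (ltW b0) andbT leNgt.
  by apply/negP => kb; apply: nob; exists k; exact: ltW.
rewrite (evE hH hE)// lee_fin.
apply: (le_trans (evD hH hE bsum (bddZ hH _ bprod))); apply: lerD.
  apply: (le_trans (ev_sum hH hE (Z := fun k w => cutoff (b / 2) (Y k w) + 4 * c ^+ 2 / b ^+ 2) _)) => //.
  rewrite (eq_bigr (fun=> excess_mean b)).
    by rewrite sumr_const card_ord mulr_natl.
  move=> k _; rewrite (evDc hH hE); last exact: (bY _ (blip_cutoff _)).
  by rewrite (idY k (blip_cutoff _)).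
rewrite (evZ hH hE)// ?(ltW K0)//.
apply: (@le_trans _ _ (K * expR (n%:R * (l * m) + 1))).
  rewrite ler_wpM2l ?(ltW K0)// (le_trans _ evfn)// prodY//.
    by move=> x; exact: expR_ge0.
  by move=> x y xy; rewrite ler_expR ler_wpM2l ?(ltW l0)// clamp_homo// lerD2r.
rewrite /K -expRD.
rewrite -[q]lnK ?posrE// -expRD ler_expR -[ln q]opprK -/L.
rewrite (_ : L = l * b); last by rewrite /l divfK// gt_eqF.
lra.
Qed.


(** Both terms of the bound are summable along [b = a * 2 ^+ j]: the first by
    the Choquet condition in dyadic form, the second because doubling [b]
    increases the second moment by at most [4 * b ^+ 2 * excess_mean b], so that
    [second_moment b / b] halves at each step up to a summable error. *)
Lemma scaled_excess_mean_bounded (a B : R) : 0 < a ->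
  (forall J, \sum_(j < J) 2 ^+ j *
     fine (V [set w | a / 4 * 2 ^+ j <= `|Y 0%N w|]) <= B) ->
  forall J, \sum_(j < J) 2 ^+ j * excess_mean (a * 2 ^+ j) <=
    B + 8 * c ^+ 2 / a ^+ 2.
Proof.
move=> a0 hB J.
apply: (@le_trans _ _ (\sum_(j < J) (2 ^+ j *
     fine (V [set w | a / 4 * 2 ^+ j <= `|Y 0%N w|]) +
     4 * c ^+ 2 / a ^+ 2 * (2 ^+ j)^-1))).
  apply: ler_sum => j _.
  have p0 : 0 < 2 ^+ j :> R by exact: exprn_gt0.
  rewrite mulrDr; apply: lerD.
    rewrite ler_pM2l// -lee_fin -(evE hH hE (bY 0 (blip_cutoff _))).
    rewrite fineK ?(cap_fin_num hH hE)//.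
    apply: (cap_ge hE) => [|w|w /= wF].
    - by case: (bY 0 (blip_cutoff (a * 2 ^+ j / 2))).
    - exact: cutoff_le1.
    - rewrite cutoff0 ?divr_gt0 ?mulr_gt0// ltNge.
      by apply/negP => h; apply: wF; rewrite (le_trans _ h)//; lra.
  rewrite le_eqVlt; apply/orP; left; apply/eqP; field.
  by rewrite !gt_eqF.
rewrite big_split/= -mulr_sumr; apply: lerD; first exact: hB.
have -> : 8 * c ^+ 2 / a ^+ 2 = 4 * c ^+ 2 / a ^+ 2 * 2 by ring.
rewrite ler_wpM2l ?sum_inv2_bounded//.
by rewrite divr_ge0 ?sqr_ge0// mulr_ge0 ?sqr_ge0.
Qed.

Lemma scaled_second_moment_bounded (a B : R) : 0 < a ->
  (forall J, \sum_(j < J) 2 ^+ j * excess_mean (a * 2 ^+ j) <= B) ->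
  forall J, \sum_(j < J) second_moment (a * 2 ^+ j) / 2 ^+ j <=
    2 * (second_moment a + 2 * a ^+ 2 * B).
Proof.
move=> a0 hB.
have := @sum_halving_bounded R (fun j => second_moment (a * 2 ^+ j) / 2 ^+ j)
  (fun j => 2 * a ^+ 2 * (2 ^+ j * excess_mean (a * 2 ^+ j))) (2 * a ^+ 2 * B).
rewrite /= expr0 mulr1 divr1; apply => [j|j|J].
- by rewrite divr_ge0 ?exprn_ge0// (le_trans _ (second_moment_ge1 _)).
- have p0 : 0 < 2 ^+ j :> R by exact: exprn_gt0.
  have -> : a * 2 ^+ j.+1 = 2 * (a * 2 ^+ j) by rewrite exprS; ring.
  rewrite ler_pdivrMr ?exprn_gt0// (le_trans (second_moment_rec _))// ?mulr_gt0//.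
  rewrite [2 ^+ j.+1]exprS le_eqVlt; apply/orP; left; apply/eqP; field.
  by rewrite gt_eqF.
- rewrite -mulr_sumr; apply: ler_wpM2l; last exact: hB.
  by rewrite mulr_ge0// sqr_ge0.
Qed.

End Estimate.

Hypothesis sV : countably_subadditive V.
Hypothesis sumY : forall a : R, 0 < a -> exists B, forall J,
  \sum_(j < J) 2 ^+ j * fine (V [set w | a * 2 ^+ j <= `|Y 0%N w|]) <= B.
Hypothesis tailY : E (fun w => Num.max (`|Y 0%N w| - c) 0) @[c --> +oo%R] --> 0%E.

(** With [b] a small multiple of [n] and [n = i * 2 ^ j], the capacities of
    the events [A i j] are summable in [j] for each [i], so Borel-Cantelli
    controls the partial sums of the non-negative variables
    [Num.max (Y k + c) 0] along each geometric sequence of indices; these partial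
    sums are monotone, so the control extends to all indices. *)
Theorem upper_strong_law (eps : R) : 0 < eps ->
  exists N : set Omega, [/\ measurable N, V N = 0%E &
    forall w, ~ N w -> exists n0, forall n, (n0 <= n)%N ->
      \sum_(k < n) Y k w <= n%:R * (fine (E (Y 0%N)) + 3 * eps)].
Proof.
move=> e0; have [c c0 [fT Te]] := excess_small tailY e0.
set mu := fine (E (Y 0%N)).
have fY := fin_num_of_excess (HY 0) tailY.
pose m := mu + c + eps.
have Wm b : 0 < b -> ev (fun w => trunc c b (Y 0%N w)) <= m.
  move=> b0; rewrite (le_trans (ev_clamp_shift_le b (HY 0) fY fT))//.
  by rewrite lerD2l.
have m0 : 0 <= m.
  rewrite (le_trans _ (Wm _ (@ltr01 R)))// -(ev_cst hE 0).
  apply: (ev_le hH hE) => [||w]; [exact: bdd_cst|exact: (bY _ (blip_trunc _ _))|].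
  exact: clamp_ge.
pose P n w := \sum_(k < n) Num.max (Y k w + c) 0.
pose b i j : R := eps * i%:R * 2 ^+ j.
pose A i j := [set w | (i * 2 ^ j)%:R * m + b i j < P (i * 2 ^ j)%N w].
have HP n : H (P n).
  apply: (rv_sum hH _ (X := fun k w => Num.max (Y k w + c) 0)) => k.
  apply: (rv_lip hH (f := fun x => Num.max (x + c) 0) (K := 1)) => // x y.
  rewrite mul1r; have := ler_norm (x - y); have := ler_norm (- (x - y)).
  rewrite normrN => h1 h2; have h0 := normr_ge0 (x - y); rewrite ler_norml /Order.max.
  by case: (ltP (x + c) 0) => h3; case: (ltP (y + c) 0) => h4; apply/andP; split; lra.
have mA i j : measurable (A i j) by exact: (rv_measurable_gt hH).
pose bet i j : R := i%:R * (2 ^+ j * excess_mean c (b i j)) +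
  expR 1 / (eps ^+ 2 * i%:R) * (second_moment c (b i j) / 2 ^+ j).
have bet0 i j : 0 <= bet i j.
  apply: addr_ge0.
    apply: mulr_ge0 => //; apply: mulr_ge0; [exact: exprn_ge0|exact: excess_mean_ge0].
  apply: mulr_ge0.
    by apply: divr_ge0; [exact: expR_ge0|apply: mulr_ge0 => //; exact: sqr_ge0].
  apply: divr_ge0; last exact: exprn_ge0.
  exact: (le_trans ler01 (second_moment_ge1 _ _)).
have Abet i j : (0 < i)%N -> (V (A i j) <= (bet i j)%:E)%E.
  move=> i0; have iR0 : 0 < i%:R :> R by rewrite ltr0n.
  have p0 : 0 < 2 ^+ j :> R by exact: exprn_gt0.
  have bij0 : 0 < b i j by rewrite !mulr_gt0.
  have n0 : (0 < i * 2 ^ j)%N by rewrite muln_gt0 i0 expn_gt0.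
  apply: (le_trans (cap_positive_sum_le n0 bij0 m0 (Wm _ bij0))).
  rewrite lee_fin natrM natrX /bet le_eqVlt; apply/orP; left; apply/eqP.
  by rewrite /b; field; rewrite !gt_eqF.
have betB i : (0 < i)%N -> exists B, forall J, \sum_(j < J) bet i j <= B.
  move=> i0; have iR0 : 0 < i%:R :> R by rewrite ltr0n.
  have a0 : 0 < eps * i%:R by rewrite mulr_gt0.
  have a40 : 0 < eps * i%:R / 4 by rewrite divr_gt0.
  have [B /(scaled_excess_mean_bounded c a0) hB] := sumY a40.
  have hB' := scaled_second_moment_bounded a0 hB.
  eexists => J; rewrite big_split/= -!mulr_sumr; apply: lerD.
    by apply: ler_wpM2l => //; exact: hB.
  apply: ler_wpM2l; last exact: hB'.
  by apply: divr_ge0; [exact: expR_ge0|apply: mulr_ge0 => //; exact: sqr_ge0].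
pose N i := \bigcap_n \bigcup_k A i.+1 (n + k)%N.
have mN i : measurable (N i).
  apply: bigcapT_measurable => n; apply: bigcupT_measurable => k; exact: mA.
have N0 i : V (N i) = 0%E.
  have [B hB] := betB i.+1 isT.
  by apply: (cap_Borel_Cantelli hH hE sV (b := bet i.+1) (B := B)) => // j; exact: Abet.
exists (\bigcup_i N i); split.
- exact: bigcupT_measurable.
- exact: (cap_null_bigcup hH hE).
move=> w wN.
have Pnd : nondecreasing_seq (P ^~ w).
  apply/nondecreasing_seqP => n; rewrite /P big_ord_recr/= lerDl.
  by rewrite le_max lexx orbT.
have me0 : 0 <= m + eps by rewrite addr_ge0// ltW.
have [|n0 hn0] := dyadic_interpolation Pnd me0 e0.
  case=> // i _; apply: contrapT => noJ; apply: wN; exists i => // n _.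
  apply: contrapT => noA; apply: noJ; exists n => j nj; rewrite leNgt.
  apply/negP => h; apply: noA; exists (j - n)%N => //; rewrite subnKC//.
  rewrite /A/=; apply: le_lt_trans h; rewrite [leRHS]mulrDr lerD2l /b natrM natrX.
  by rewrite -mulrA mulrC.
exists n0 => n nn0; have := hn0 n nn0.
have : \sum_(k < n) Y k w <= P n w - n%:R * c.
  rewrite /P lerBrDr -[n%:R](_ : \sum_(k < n) 1 = _); last first.
    by rewrite sumr_const card_ord.
  rewrite mulr_suml -big_split/=; apply: ler_sum => k _.
  by rewrite mul1r le_max lexx.
rewrite /m; nra.
Qed.

End UpperLaw.

(** * Strong law under a product bound *)

Section LimitSuperior.
Variable R : realType.
Implicit Type u : (\bar R)^nat.
Local Open Scope ereal_scope.

Lemma limn_esup_le_eventually u x n0 : (forall n, (n0 <= n)%N -> u n <= x) ->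
  limn_esup u <= x.
Proof.
move=> ux; rewrite limn_esup_lim; apply: lime_le; first exact: is_cvg_esups.
near=> n; apply: ge_ereal_sup => _ [k /= nk <-]; apply: ux.
by rewrite (leq_trans _ nk)//; near: n; exists n0.
Unshelve. all: by end_near. Qed.

Lemma limn_esup_lty_bounded u : limn_esup u < +oo ->
  exists K n0, forall n, (n0 <= n)%N -> u n <= K%:E.
Proof.
move=> /ereal_inf_lt[_ [A [n0 _ nA] <-]] sA.
have uA n : (n0 <= n)%N -> u n <= ereal_sup (u @` A).
  by move=> n0n; apply: ereal_sup_ubound; exists n => //; exact: nA.
case: (ereal_sup _) sA uA => [K _ h|//|_ h]; first by exists K, n0.
by exists 0%R, n0 => n /h/le_trans; apply; exact: leNye.
Qed.

Lemma cvg_of_limsup_le_liminf u (l : R) : limn_esup u <= l%:E -> l%:E <= limn_einf u ->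
  u @ \oo --> l%:E.
Proof.
move=> ul lu; have le := limn_einf_sup u.
have -> : l%:E = limn_esup u by apply/eqP; rewrite eq_le ul (le_trans lu le).
have ee : limn_einf u = limn_esup u.
  by apply/eqP; rewrite eq_le le (le_trans ul lu).
apply: (@squeeze_cvge _ _ _ _ (einfs u) _ (esups u)).
- apply: nearW => n; apply/andP; split.
    by apply: ereal_inf_lbound; exists n => /=.
  by apply: ereal_sup_ubound; exists n => /=.
- by rewrite -ee limn_einf_lim; exact: is_cvg_einfs.
- by rewrite limn_esup_lim; exact: is_cvg_esups.
Qed.

End LimitSuperior.

Section Choquet.
Context d (Omega : measurableType d) (R : realType).
Variables (H : set (Omega -> R)) (E : (Omega -> R) -> \bar R).
Hypotheses (hH : rv_space H) (hE : sublinear_expectation H E).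
Let V := capacity H E.
Variable X : Omega -> R.

Let tail (t : R) := fine (V [set w | t <= `|X w|]).

Let tail_ge0 t : 0 <= tail t.
Proof. by rewrite fine_ge0// (cap_ge0 hH hE). Qed.

Let tail_ni : nonincreasing_fun tail.
Proof.
move=> s t st; apply: fine_le; rewrite ?(cap_fin_num hH hE)//.
by apply: cap_mono => w /=; exact: le_trans.
Qed.

Lemma choquet_normE : choquet V (fun w => `|X w|) =
  (\int[lebesgue_measure]_(t in `[0%R, +oo[%classic) (tail t)%:E)%E.
Proof.
rewrite /choquet [X in (_ + X)%E]integral0_eq ?adde0.
  by apply: eq_integral => t _; rewrite fineK// (cap_fin_num hH hE).
move=> t; rewrite /= in_itv/= => t0.
have -> : [set w | t <= `|X w|] = setT.
  by apply/seteqP; split=> w //= _; exact: le_trans t0 _.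
by rewrite /V (cap_setT hH hE) subee.
Qed.

Lemma choquet_dyadic_bounded (a : R) : 0 < a ->
  (choquet V (fun w => `|X w|%R) < +oo)%E ->
  exists B, forall J, \sum_(j < J) 2 ^+ j * tail (a * 2 ^+ j) <= B.
Proof.
rewrite choquet_normE => a0 /(integral_nonincreasing_sum_bounded tail_ge0 tail_ni a0)[B hB].
exists (2 * B) => J.
have := condensation_bounded (G := fun k => tail (a * k%:R)) _ _ hB J.
under eq_bigr do rewrite natrX; apply=> [k|m n mn]; first exact: tail_ge0.
by apply: tail_ni; rewrite ler_wpM2l ?ler_nat// ltW.
Qed.

Lemma choquet_lty (a B : R) : 0 < a ->
  (forall N, \sum_(k < N) tail (a * k.+1%:R) <= B) ->
  (choquet V (fun w => `|X w|%R) < +oo)%E.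
Proof.
rewrite choquet_normE => a0.
exact: (integral_nonincreasing_lty tail_ge0 tail_ni a0).
Qed.

End Choquet.

Section StrongLaw.
Context d (Omega : measurableType d) (R : realType).
Variables (H : set (Omega -> R)) (E : (Omega -> R) -> \bar R).
Hypotheses (hH : rv_space H) (hE : sublinear_expectation H E).
Let V := capacity H E.
Local Notation ev := (ev E).
Variable X : nat -> Omega -> R.
Hypothesis HX : forall n, H (X n).
Hypothesis idX : identically_distributed E X.

Section Product.
Hypothesis prodX : forall (f : R -> R) n, blip (f : R^o -> R) ->
  (forall x, 0 <= f x) -> {homo f : x y / x <= y} \/ {homo f : x y /~ x <= y} ->
  ev (fun w => \prod_(k < n) f (X k w)) <= ev (fun w => f (X 0%N w)) ^+ n.
Hypothesis sV : countably_subadditive V.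
Hypothesis choquetX : (choquet V (fun w => `|X 0%N w|%R) < +oo)%E.
Hypothesis tailX : E (fun w => Num.max (`|X 0%N w| - c) 0) @[c --> +oo%R] --> 0%E.

Let blip_neg (f : R -> R) : blip (f : R^o -> R) -> blip (fun x : R^o => f (- x)).
Proof.
move=> bf; apply: (@blip_comp _ R^o R^o (fun x => - x) f) => // x y.
by rewrite -opprD normrN.
Qed.

Lemma fin_num_mean : E (X 0%N) \is a fin_num.
Proof. exact: (fin_num_of_excess hH hE (HX 0) tailX). Qed.

Lemma fin_num_meanN : E (fun w => - X 0%N w) \is a fin_num.
Proof.
apply: (fin_num_of_excess hH hE (rv_opp hH (HX 0))).
by under eq_fun do under eq_fun do rewrite normrN.
Qed.

Lemma upper_strong_law_of_products (eps : R) : 0 < eps ->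
  exists N : set Omega, [/\ measurable N, V N = 0%E &
    forall w, ~ N w -> exists n0, forall n, (n0 <= n)%N ->
      \sum_(k < n) X k w <= n%:R * (fine (E (X 0%N)) + 3 * eps)].
Proof.
apply: (@upper_strong_law _ _ _ _ _ hH hE X) => //.
- by move=> f n bf; exact: (ev_identically_distributed hH hE HX n idX bf).
- by move=> f n bf f0 fm; apply: prodX => //; left.
- by move=> a a0; exact: (choquet_dyadic_bounded hH hE a0 choquetX).
Qed.

(** The upper law for [- X]: a non-decreasing function of [- X] is a
    non-increasing function of [X], so the product bound is needed for both
    directions of monotonicity. *)
Lemma lower_strong_law (eps : R) : 0 < eps ->
  exists N : set Omega, [/\ measurable N, V N = 0%E &
    forall w, ~ N w -> exists n0, forall n, (n0 <= n)%N ->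
      \sum_(k < n) - X k w <= n%:R * (fine (E (fun w => - X 0%N w)) + 3 * eps)].
Proof.
apply: (@upper_strong_law _ _ _ _ _ hH hE (fun n w => - X n w)) => //.
- by move=> n; exact: rv_opp.
- move=> f n bf.
  by rewrite (ev_identically_distributed hH hE HX n (f := fun x => f (- x)) idX (blip_neg bf)).
- move=> f n bf f0 fm; apply: (prodX (f := fun x => f (- x))) => //.
    exact: blip_neg.
  by right => x y xy; apply: fm; rewrite lerN2.
- move=> a a0; have [B hB] := choquet_dyadic_bounded hH hE a0 choquetX.
  by exists B => J; under eq_bigr do under eq_set do rewrite normrN; exact: hB.
- by under eq_fun do under eq_fun do rewrite normrN.
Qed.

Theorem strong_law_null :
  exists N : set Omega, [/\ measurable N, V N = 0%E &
   forall w, ~ N w ->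
    (conjugate E (X 0%N) <= limn_einf (fun n => (sample_mean X w n)%:E))%E /\
    (limn_esup (fun n => (sample_mean X w n)%:E) <= E (X 0%N))%E].
Proof.
have e0 p : 0 < p.+1%:R^-1 / 3 :> R by rewrite divr_gt0.
have up p : exists N : set Omega, [/\ measurable N, V N = 0%E &
    forall w, ~ N w -> exists n0, forall n, (n0 <= n)%N ->
      \sum_(k < n) X k w <= n%:R * (fine (E (X 0%N)) + p.+1%:R^-1)].
  have [N [mN N0 hN]] := upper_strong_law_of_products (e0 p).
  by exists N; split=> // w /hN; rewrite mulrCA divff// mulr1.
have lo p : exists N : set Omega, [/\ measurable N, V N = 0%E &
    forall w, ~ N w -> exists n0, forall n, (n0 <= n)%N ->
      \sum_(k < n) - X k w <= n%:R * (fine (E (fun w => - X 0%N w)) + p.+1%:R^-1)].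
  have [N [mN N0 hN]] := lower_strong_law (e0 p).
  by exists N; split=> // w /hN; rewrite mulrCA divff// mulr1.
have {up}[Nu hNu] := choice up; have {lo}[Nl hNl] := choice lo.
exists (\bigcup_p (Nu p `|` Nl p)); split.
- by apply: bigcupT_measurable => p; have [? _ _] := hNu p; have [? _ _] := hNl p;
    exact: measurableU.
- apply: (cap_null_bigcup hH hE sV) => p; have [mu V0u _] := hNu p; have [ml V0l _] := hNl p.
    exact: measurableU.
  apply/eqP; rewrite eq_le (cap_ge0 hH hE) andbT.
  by rewrite (le_trans (capU hH hE _ _))// -/V V0u V0l adde0.
move=> w wN.
have mean_le (Z : nat -> Omega -> R) (m : R) :
   (forall p, exists n0, forall n, (n0 <= n)%N ->
     \sum_(k < n) Z k w <= n%:R * (m + p.+1%:R^-1)) ->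
   (limn_esup (fun n => (sample_mean Z w n)%:E) <= m%:E)%E.
  move=> hZ; apply/lee_addgt0Pr => e e_gt0.
  pose p := Num.truncn e^-1.
  have pe : p.+1%:R^-1 <= e.
    have ei : 0 <= e^-1 by rewrite invr_ge0 ltW.
    by rewrite invf_ple ?posrE//; have /andP[_ /ltW] := truncn_itv ei.
  have [n0 hn0] := hZ p; apply: (@limn_esup_le_eventually _ _ _ n0) => n n0n.
  rewrite -EFinD lee_fin /sample_mean ler_pdivrMr// mulrC.
  apply: (le_trans (hn0 n.+1 (leqW n0n))).
  by rewrite ler_wpM2l// lerD2l.
split; last first.
  rewrite -(fineK fin_num_mean); apply: mean_le => p.
  have [_ _] := hNu p; apply => Nw; apply: wN; exists p => //; by left.
have -> : limn_einf (fun n => (sample_mean X w n)%:E) =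
    (- limn_esup (fun n => (sample_mean (fun n w => - X n w) w n)%:E))%E.
  rewrite /limn_einf; congr (- limn_esup _)%E; apply/funext => n.
  by rewrite /sample_mean /partial_sum sumrN mulNr EFinN.
rewrite /conjugate leeN2 -(fineK fin_num_meanN).
apply: mean_le => p.
by have [_ _] := hNl p; apply => Nw; apply: wN; exists p => //; right.
Qed.

End Product.

End StrongLaw.

(** * Independence under a continuous capacity *)

Section ContinuousCapacity.
Context d (Omega : measurableType d) (R : realType).
Variables (H : set (Omega -> R)) (E : (Omega -> R) -> \bar R).
Hypotheses (hH : rv_space H) (hE : sublinear_expectation H E).
Let V := capacity H E.
Local Notation ev := (ev E).
Variable X : nat -> Omega -> R.
Hypothesis HX : forall n, H (X n).
Hypotheses (indX : independent_seq H E X) (idX : identically_distributed E X).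
Hypothesis cV : continuous_capacity V.

Lemma cap_bigcap_ge (A : nat -> set Omega) (x : \bar R) :
  (forall n, measurable (A n)) -> (forall m n, (m <= n)%N -> A n `<=` A m) ->
  (forall n, (x <= V (A n))%E) -> (x <= V (\bigcap_n A n))%E.
Proof.
move=> mA Ani xA.
have Ani' : nonincreasing_seq A.
  by move=> m n mn; apply/subsetPset; exact: Ani.
have cv := cV.2 A mA Ani'.
rewrite -(cvg_lim _ cv)//; apply: lime_ge; first exact: cvgP cv.
exact: nearW.
Qed.

(** The converse half of Borel-Cantelli: by independence the lower expectation
    of [\prod_j (1 - cutoff (b j) (X j))] is the product of the lower
    expectations, hence at most [expR (- \sum_j p j)]. *)
Lemma cap_bigcup_eq1 (b : nat -> R) n : (forall k, 0 < b k) ->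
  (forall B, exists N, B < \sum_(k < N) fine (V [set w | b k <= `|X 0%N w|])) ->
  V (\bigcup_k [set w | b (n + k)%N / 3 < `|X (n + k)%N w|]) = 1%E.
Proof.
move=> b0 bV; set D := \bigcup_k _.
apply/eqP; rewrite eq_le (cap_le1 hH hE)/=.
pose p k := ev (fun w => cutoff (b k) (X 0%N w)).
have bcut k j : bdd_rv H (fun w => cutoff (b k) (X j w)).
  exact: (bdd_blip hH (blip_cutoff _)).
have p0 k : 0 <= p k.
  rewrite -(ev_cst hE 0); apply: (ev_le hH hE) => // [|w]; [exact: bdd_cst|exact: cutoff_ge0].
have p1 k : p k <= 1.
  rewrite -(ev_cst hE 1); apply: (ev_le hH hE) => // [|w]; [exact: bdd_cst|exact: cutoff_le1].
have Vp k : fine (V [set w | b k <= `|X 0%N w|]) <= p k.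
  rewrite -lee_fin fineK ?(cap_fin_num hH hE)// -(evE hH hE (bcut k 0)).
  apply: cap_le => [|w|w /= h]; [by case: (bcut k 0)|exact: cutoff_ge0|].
  by rewrite cutoff1.
have key l : ((1 - expR (- \sum_(j < l) p (n + j)%N))%:E <= V D)%E.
  pose f k x := 1 - cutoff (b k) x.
  have bf k : blip (f k : R^o -> R).
    by apply: blipD; [exact: blip_cst|apply: blipN; exact: blip_cutoff].
  have f0 k x : 0 <= f k x by rewrite subr_ge0 cutoff_le1.
  have f1 k x : f k x <= 1 by rewrite gerBl cutoff_ge0.
  have r0 k : 0 <= 1 - p k by rewrite subr_ge0.
  have fr k : ev (fun w => -1 * f k (X 0%N w)) = -1 * (1 - p k).
    under eq_fun do rewrite /f mulN1r opprB.
    by rewrite (evDc hH hE)// mulN1r opprB.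
  have pc m c' : prefix_fun X m (fun=> c') by exact: prefix_fun_cst.
  have := ev_prod_independent hH hE HX indX idX l (pc n 1) (pc n 1) (fun=> ler01) bf f0 r0 fr.
  rewrite (ev_cst hE) !mulN1r !mul1r => evP.
  set xi := (fun w => _) in evP.
  have bxi : bdd_rv H xi.
    apply: (@prefix_fun_bdd _ _ _ _ hH _ HX (n + l)).
    apply: prefix_funD => //.
    have -> : (fun w => -1 * (1 * \prod_(j < l) f (n + j)%N (X (n + j)%N w))) =
        fun w => -1 * \prod_(j < l) f (n + j)%N (X (n + j)%N w).
      by apply/funext => w; rewrite mul1r.
    by apply: prefix_funM => //; exact: prefix_fun_prod.
  apply: (@le_trans _ _ (E xi)); last first.
    apply: (cap_ge hE) => [|w|w /= wD]; first by case: bxi.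
      rewrite /xi mulN1r mul1r gerBl; exact: prodr_ge0.
    rewrite /xi mulN1r mul1r big1 ?subrr// => j _.
    rewrite /f cutoff0 ?subr0// ltNge; apply/negP => h.
    apply: wD; exists j => //=; apply: lt_le_trans h.
    by have := b0 (n + j)%N; lra.
  rewrite (evE hH hE bxi) evP lee_fin lerD2l lerN2 -sumrN expR_sum.
  apply: ler_prod => j _; rewrite r0/=.
  exact: expR_ge1Dx.
apply/lee_addgt0Pr => e e0.
have [N hN] := bV (n%:R - ln e).
have sumN : \sum_(k < N) fine (V [set w | b k <= `|X 0%N w|]) <=
    n%:R + \sum_(j < N) p (n + j)%N.
  apply: (@le_trans _ _ (\sum_(k < N) p k)); first exact: ler_sum.
  apply: (@le_trans _ _ (\sum_(k < n + N) p k)).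
    by rewrite addnC big_split_ord/= lerDl sumr_ge0.
  rewrite big_split_ord/= lerD2r -[n%:R](_ : \sum_(k < n) 1 = _) ?ler_sum//.
  by rewrite sumr_const card_ord.
rewrite -leeBlDr//; apply: le_trans (key N); rewrite -EFinB lee_fin lerD2l lerN2.
by rewrite -[leRHS]lnK ?posrE// ler_expR; lra.
Qed.

(** If the Choquet integral is infinite, then every tail event
    [|X k| > (n + 1) * (k + 1) / 3 for some k >= n] has capacity 1. The threshold
    grows with [n], so on the intersection, which has capacity 1 by continuity
    from above, [|X k| / (k + 1)] and with it the ratio of partial sums is
    unbounded. *)
Lemma choquet_lty_of_limsup_bounded :
  (V [set w | limn_esup (fun n => `|sample_mean X w n|%:E) = +oo%E] < 1)%E ->
  (choquet V (fun w => `|X 0%N w|%R) < +oo)%E.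
Proof.
apply: contraPT => noC; apply/negP; rewrite -leNgt.
pose b n k : R := n.+1%:R * k.+1%:R.
pose D n := \bigcup_k [set w | b n (n + k)%N / 3 < `|X (n + k)%N w|].
have b0 n k : 0 < b n k by rewrite mulr_gt0.
have DV n : V (D n) = 1%E.
  apply: cap_bigcup_eq1 => // B; apply: contrapT => hB; move/negP: noC; apply.
  apply: (choquet_lty hH hE (ltr0Sn R n) (B := B)) => N.
  by rewrite leNgt; apply/negP => h; apply: hB; exists N.
have mD n : measurable (D n).
  apply: bigcupT_measurable => k.
  apply: (rv_measurable_gt hH (X := fun w => `|X (n + k)%N w|)).
  apply: (rv_lip hH (f := fun x => `|x|) (K := 1)) => // x y.
  by rewrite mul1r ler_dist_dist.
have Dni m n : (m <= n)%N -> D n `<=` D m.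
  move=> mn w [k _ /= h]; exists (n - m + k)%N => //=.
  rewrite addnA subnKC//; apply: le_lt_trans h.
  by rewrite ler_pM2r// /b ler_pM2r// ler_nat.
have : (1 <= V (\bigcap_n D n))%E.
  by apply: cap_bigcap_ge => // n; rewrite DV.
move/le_trans; apply; apply: cap_mono => w wD /=.
apply/eqP; rewrite -leye_eq leNgt; apply/negP => /limn_esup_lty_bounded[K0 [n0 hK]].
pose K := Num.max K0 0.
have K_ge0 : 0 <= K by rewrite le_max lexx orbT.
have SK n : (n0 <= n)%N -> `|partial_sum X n.+1 w| <= K * n.+1%:R.
  move=> /hK; rewrite lee_fin /sample_mean normrM normfV (ger0_norm (ler0n _ _)).
  rewrite ler_pdivrMr// => /le_trans; apply.
  by rewrite ler_pM2r// le_max lexx.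
pose n := maxn n0.+1 (Num.truncn (6 * K)).
have nK : 6 * K <= n.+1%:R.
  have K60 : 0 <= 6 * K by rewrite mulr_ge0.
  have /andP[_ /ltW/le_trans] := truncn_itv K60; apply.
  by rewrite ler_nat ltnS leq_maxr.
have [k _ /=] := wD n I; apply/negP; rewrite -leNgt.
have nn0 : (n0.+1 <= n + k)%N by rewrite (leq_trans (leq_maxl _ _) (leq_addr _ _)).
set j := (n + k)%N in nn0 *.
have -> : X j w = partial_sum X j.+1 w - partial_sum X j w.
  by rewrite /partial_sum big_ord_recr/= [RHS]addrAC subrr add0r.
have S1 := SK j (ltnW nn0).
have S2 : `|partial_sum X j w| <= K * j.+1%:R.
  case: j nn0 {S1} => // j; rewrite ltnS => /SK/le_trans; apply.
  by rewrite ler_wpM2l// ler_nat.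
apply: (le_trans (ler_normB _ _)); apply: (le_trans (lerD S1 S2)).
rewrite /b; have : 0 <= j.+1%:R :> R by [].
nra.
Qed.

Section Certainty.

Lemma expR_le_quadratic (x : R) : x <= 1 -> expR x <= 1 + x + expR 1 * x ^+ 2.
Proof.
move=> x1; have e1 : 1 <= expR 1 :> R by have := expR_ge1Dx (1 : R); lra.
have [x0|x0] := leP 0 x.
  by have := expR_quadratic_bound x0 ltr01 x1; rewrite divr1 mulrC.
have h := expR_ge1Dx (- x); rewrite expRN in h.
have e0 := expR_gt0 x.
have : expR x * (1 - x) <= 1 by rewrite -ler_pdivlMl// mulr1.
have : 0 <= (expR 1 - 1) * x ^+ 2 by rewrite mulr_ge0 ?sqr_ge0// subr_ge0.
have : 0 <= - x * x ^+ 2 by rewrite mulr_ge0 ?sqr_ge0// oppr_ge0 ltW.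
move=> x3; have : 1 <= (1 + x + x ^+ 2) * (1 - x) by lra.
nra.
Qed.

Variables (f : bool -> R -> R) (r : bool -> R) (rho : R).
Hypothesis bf : forall s, blip (f s : R^o -> R).
Hypothesis f0 : forall s x, 0 <= f s x.
Hypothesis fV : forall x, f true x * f false x = 1.
Hypothesis fr : forall s, ev (fun w => -1 * f s (X 0%N w)) = -1 * r s.
Hypothesis r0 : forall s, 0 <= r s.
Hypothesis r_rho : forall s, r s <= rho.
Hypothesis rho1 : rho < 1.

(** Two mutually inverse positive functions of [X] cannot both have lower
    expectation [r s] below 1. Over a long window the product [U true] of the
    values of [f true] and the product [U false = (U true)^-1] would both have
    small lower expectation, so that each of [U true < 1] and [U false < 1] would
    have capacity close to 1. For disjoint windows of increasing length and any
    prescribed choice of [true] or [false] in each window, independence makes the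
    capacity that all choices are realised at least [1 / 2]. The events
    [Cl (sw n)], with the choice [true] exactly in the first [n] windows, are
    disjoint, so the unions [D n] of the tails of this sequence of events decrease
    to the empty set while keeping capacity at least [1 / 2]: this contradicts
    continuity from above. *)
Lemma contracting_pair_false : False.
Proof.
have rho0 : 0 <= rho by rewrite (le_trans (r0 true)).
have [L L0 rhoL] : exists2 L, (0 < L)%N & rho ^+ L <= 1 / 2.
  have := @cvg_expr R rho; rewrite ger0_norm// => /(_ rho1)/cvgr0Pnorm_le.
  move=> /(_ (1 / 2))[//|L _ hL]; exists L.+1 => //.
  by have := hL L.+1 (leqnSn L); rewrite /= ger0_norm// exprn_ge0.
pose len j := (L * j.+2)%N.
pose pos := fix pos j := if j is j'.+1 then (pos j' + len j')%N else 0%N.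
pose U (s : bool) j w := \prod_(i < len j) f s (X (pos j + i)%N w).
have U0 s j w : 0 <= U s j w by exact: prodr_ge0.
have pU s j : prefix_fun X (pos j.+1) (U s j).
  exact: (@prefix_fun_prod _ _ _ X (fun _ => f s) (pos j) (len j) (fun _ => bf s)).
have bU s j : bdd_rv H (U s j) by exact: (prefix_fun_bdd hH HX (pU s j)).
have rlen s j : r s ^+ len j <= (1 / 2) ^+ j.+2.
  rewrite /len exprM lerXn2r ?nnegrE ?exprn_ge0//.
  by rewrite (le_trans _ rhoL)// lerXn2r ?nnegrE.
(* linear in the window products, hence of computable expectation, and at
   most the indicator of C s J when c = 1 *)
pose Y (s : nat -> bool) J c w := c - \sum_(j < J) U (s j) j w.
have pos_mono j J : (j <= J)%N -> (pos j <= pos J)%N.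
  elim: J => [|J IH]; first by rewrite leqn0 => /eqP ->.
  rewrite leq_eqVlt => /orP[/eqP -> //|]; rewrite ltnS => /IH h.
  by rewrite (leq_trans h)//= leq_addr.
have pY s J c : prefix_fun X (pos J) (Y s J c).
  elim: J => [|J IH].
    by rewrite /Y; under eq_fun do rewrite big_ord0; exact: prefix_fun_cst.
  rewrite /Y; under eq_fun do rewrite big_ord_recr/= opprD addrA.
  apply: prefix_funD; first by apply: prefix_fun_widen IH; exact: pos_mono.
  under eq_fun do rewrite -mulN1r.
  by apply: prefix_funM; [exact: prefix_fun_cst|exact: pU].
have evY s J c : ev (Y s J c) = c - \sum_(j < J) r (s j) ^+ len j.
  elim: J c => [|J IH] c.
    by rewrite /Y; under eq_fun do rewrite big_ord0; rewrite big_ord0 (ev_cst hE).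
  have pc m c' : prefix_fun X m (fun=> c') by exact: prefix_fun_cst.
  have := ev_prod_independent hH hE HX indX idX (len J) (pY s J c) (pc (pos J) 1)
    (fun=> ler01) (fun _ => bf (s J)) (fun _ => f0 (s J)) (fun _ => r0 (s J)) (fun _ => fr (s J)).
  have -> : (fun w => Y s J c w + -1 * (1 * \prod_(j < len J) f (s J) (X (pos J + j)%N w))) =
      Y s J.+1 c.
    by apply/funext => w; rewrite /Y big_ord_recr/= mulN1r mul1r opprD addrA.
  move=> ->; rewrite big_ord_recr/= opprD.
  have -> : (fun w => Y s J c w + -1 * (1 * \prod_(j < len J) r (s J))) =
      Y s J (c - r (s J) ^+ len J).
    by apply/funext => w; rewrite /Y prodr_const card_ord mulN1r mul1r addrAC.
  by rewrite IH addrAC addrA.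
pose C (s : nat -> bool) J := \bigcap_(j in [set j | (j < J)%N]) [set w | 0 < 1 - U (s j) j w].
have mC s J : measurable (C s J).
  apply: bigcap_measurableType => j _; apply: (rv_measurable_gt hH (X := fun w => 1 - U (s j) j w)).
  by apply: (rv_add hH); [exact: rv_cst|apply: (rv_opp hH); case: (bU (s j) j)].
have CV s J : ((1 / 2)%:E <= V (C s J))%E.
  have bY : bdd_rv H (Y s J 1) by exact: (prefix_fun_bdd hH HX (pY s J 1)).
  apply: (@le_trans _ _ (E (Y s J 1))).
    rewrite (evE hH hE bY) evY lee_fin.
    suff : \sum_(j < J) r (s j) ^+ len j <= 1 / 2 by lra.
    apply: (@le_trans _ _ (\sum_(j < J) 1 / 4 * (2 ^+ j)^-1)).
      apply: ler_sum => j _; rewrite (le_trans (rlen _ _))//.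
      rewrite exprMn expr1n mul1r -exprVn !exprS le_eqVlt; apply/orP; left; apply/eqP.
      by field.
    by rewrite -mulr_sumr; have := sum_inv2_bounded R J; lra.
  apply: (cap_ge hE) => [|w|w wC]; first by case: bY.
    by rewrite /Y gerBl sumr_ge0.
  have [j [jJ Uj]] : exists j, (j < J)%N /\ 1 <= U (s j) j w.
    apply: contrapT => noj; apply: wC => j /= jJ; rewrite subr_gt0 ltNge.
    by apply/negP => h; apply: noj; exists j.
  rewrite /Y subr_le0 (bigD1 (Ordinal jJ))//= (le_trans Uj)// lerDl.
  exact: sumr_ge0.
pose Cl s := \bigcap_J C s J.
have mCl s : measurable (Cl s) by exact: bigcapT_measurable.
have ClV s : ((1 / 2)%:E <= V (Cl s))%E.
  apply: cap_bigcap_ge => // m n mn w h j /= jm; apply: h => /=.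
  exact: leq_trans mn.
pose sw n j := (j < n)%N.
pose D n := \bigcup_k Cl (sw (n + k)%N).
have : ((1 / 2)%:E <= V (\bigcap_n D n))%E.
  apply: cap_bigcap_ge => [n|m n mn w [k _ h]|n].
  - exact: bigcupT_measurable.
  - by exists (n - m + k)%N => //; rewrite addnA subnKC.
  - apply: (le_trans (ClV (sw n))); apply: cap_mono => w h.
    by exists 0%N => //; rewrite addn0.
have -> : \bigcap_n D n = set0.
  apply/seteqP; split=> // w wD; have [m _ hm] := wD 0%N I.
  have [k _ hk] := wD m.+1 I.
  have /(_ (ltnSn m)) := hm m.+1 I m; have /(_ (ltnSn m)) := hk m.+1 I m.
  rewrite /sw add0n ltnn ltnS leq_addr /= !subr_gt0 => h1 h2.
  have : U true m w * U false m w = 1.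
    by rewrite -big_split/= big1.
  have := U0 true m w; have := U0 false m w; nra.
by rewrite /V (cap_set0 hH hE) lee_fin; lra.
Qed.

End Certainty.

(** Continuity of the capacity forces upper and lower expectations to agree:
    if some [beta] lay strictly between them, then for small [l] both
    [expR (- (l * (h x - beta)))] and its inverse would have lower expectation
    below 1, to first order in [l]. *)
Lemma mean_certainty (h : R -> R) : blip (h : R^o -> R) ->
  ev (fun w => h (X 0%N w)) <= - ev (fun w => - h (X 0%N w)).
Proof.
move=> bh; rewrite leNgt; apply/negP => gap.
set mu := ev (fun w => h (X 0%N w)) in gap; set nu := - ev _ in gap.
pose beta := (mu + nu) / 2; pose gam := (mu - nu) / 2.
have gam0 : 0 < gam by rewrite divr_gt0// subr_gt0.
have bg : blip (fun x : R^o => h x - beta) by apply: blipD => //; exact: blip_cst.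
have [K K0 hK] := bg.
pose e : R := expR 1; have e0 : 0 < e by exact: expR_gt0.
pose D := 2 * e * (K ^+ 2 + 1); have D0 : 0 < D by rewrite !mulr_gt0// ltr_wpDl ?sqr_ge0.
(* the first bound makes the exponents at most 1, the second makes the
   quadratic remainder at most half of the first-order gain *)
pose l := Num.min (K + 1)^-1 (gam / D).
have l0 : 0 < l by rewrite lt_min invr_gt0 ltr_wpDl//= divr_gt0.
have lK : l * K <= 1.
  rewrite (@le_trans _ _ ((K + 1)^-1 * K))//; last first.
    by rewrite mulrC ler_pdivrMr ?ltr_wpDl// mul1r lerDl.
  by rewrite ler_wpM2r// ge_min lexx.
have lD : l * D <= gam by rewrite -ler_pdivlMr// ge_min lexx orbT.
pose sg (s : bool) : R := if s then 1 else -1.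
pose f s x := expR (- (l * sg s * (h x - beta))).
have bf s : blip (f s : R^o -> R).
  apply: blip_expR_comp; apply: blipN; apply: blipM => //; exact: blip_cst.
pose r s := - ev (fun w => - f s (X 0%N w)).
have bfX s : bdd_rv H (fun w => f s (X 0%N w)) by exact: (bdd_blip hH (bf s)).
have bhX : bdd_rv H (fun w => h (X 0%N w)) by exact: (bdd_blip hH bh).
apply: (@contracting_pair_false f r (1 - l * gam / 2)) => //.
- by move=> s x; exact: expR_ge0.
- by move=> x; rewrite /f -expRD /sg -[RHS]expR0; congr expR; ring.
- by move=> s; under eq_fun do rewrite mulN1r; rewrite mulN1r opprK.
- move=> s; rewrite oppr_ge0 -(ev_cst hE 0); apply: (ev_le hH hE).
  + exact: bddN.
  + exact: bdd_cst.
  + by move=> w; rewrite oppr_le0 expR_ge0.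
- move=> s; rewrite /r lerNl.
  have hs : gam <= ev (fun w => sg s * h (X 0%N w)) - sg s * beta.
    case: s => /=; rewrite /sg.
      under eq_fun do rewrite mul1r.
      by rewrite -/mu /gam /beta; lra.
    under eq_fun do rewrite mulN1r.
    rewrite -[ev _]opprK -/nu /gam /beta; lra.
  have b1 : bdd_rv H (fun w => sg s * h (X 0%N w)) by exact: bddZ.
  have b2 := bddZ hH l b1.
  apply: (@le_trans _ _ (ev (fun w => l * (sg s * h (X 0%N w)) +
      (- (l * (sg s * beta)) - 1 - e * (l * K) ^+ 2)))).
    rewrite (evDc hH hE _ b2) (evZ hH hE b1) ?(ltW l0)//.
    have : l * gam <= l * (ev (fun w => sg s * h (X 0%N w)) - sg s * beta).
      by rewrite ler_pM2l.
    have : e * (l * K) ^+ 2 <= l * gam / 2.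
      have -> : e * (l * K) ^+ 2 = l * (l * (e * K ^+ 2)) by ring.
      rewrite -mulrA ler_pM2l//.
      have : l * (e * K ^+ 2) <= l * (D / 2).
        by rewrite ler_pM2l// /D; nra.
      by lra.
    lra.
  apply: (ev_le hH hE).
  + by apply: bddD => //; exact: bdd_cst.
  + exact: bddN.
  + move=> w; have [hw _] := hK (X 0%N w) (X 0%N w).
    rewrite /f; set t := _ * (h (X 0%N w) - beta).
    have tK : `|t| <= l * K.
      rewrite /t !normrM (gtr0_norm l0) (_ : `|sg s| = 1) ?mulr1; last first.
        by rewrite /sg; case: (s); rewrite ?normrN normr1.
      by rewrite ler_pM2l.
    have t1 : - t <= 1 by rewrite (le_trans _ lK)// (le_trans _ tK)// -normrN ler_norm.
    have := expR_le_quadratic t1; rewrite sqrrN -/e => ht.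
    have : e * t ^+ 2 <= e * (l * K) ^+ 2.
      by rewrite ler_pM2l// -(real_normK (num_real t)) lerXn2r ?nnegrE// mulr_ge0// ltW.
    have : t = l * (sg s * h (X 0%N w)) - l * (sg s * beta) by rewrite /t; ring.
    lra.
- by rewrite gtrBl divr_gt0// mulr_gt0.
Qed.

End ContinuousCapacity.

(** * Strong law for independent sequences *)

Section IndependentStrongLaw.
Context d (Omega : measurableType d) (R : realType).
Variables (H : set (Omega -> R)) (E : (Omega -> R) -> \bar R).
Hypotheses (hH : rv_space H) (hE : sublinear_expectation H E).
Let V := capacity H E.
Local Notation ev := (ev E).
Variable X : nat -> Omega -> R.
Hypothesis HX : forall n, H (X n).
Hypotheses (indX : independent_seq H E X) (idX : identically_distributed E X).
Hypothesis cV : continuous_capacity V.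
Hypothesis tailX : E (fun w => Num.max (`|X 0%N w| - c) 0) @[c --> +oo%R] --> 0%E.

Lemma ev_prod_identical (f : R -> R) n : blip (f : R^o -> R) ->
  (forall x, 0 <= f x) ->
  ev (fun w => \prod_(k < n) f (X k w)) = ev (fun w => f (X 0%N w)) ^+ n.
Proof.
move=> bf f0; have r0 : 0 <= ev (fun w => f (X 0%N w)).
  rewrite -(ev_cst hE 0); apply: (ev_le hH hE) => //; first exact: bdd_cst.
  exact: (bdd_blip hH bf).
have p0 c : prefix_fun X 0 (fun=> c) by exact: prefix_fun_cst.
have fr (k : nat) : ev (fun w => 1 * f (X 0%N w)) = 1 * ev (fun w => f (X 0%N w)).
  by under eq_fun do rewrite mul1r; rewrite mul1r.
have := ev_prod_independent hH hE HX indX idX n (p0 0) (p0 1) (fun=> ler01)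
  (fun=> bf) (fun _ => f0) (fun=> r0) fr.
rewrite (ev_cst hE) prodr_const card_ord add0r !mul1r => <-.
by congr ev; apply/funext => w; rewrite add0r !mul1r.
Qed.

Lemma mean_le_of_excess (Y Z T : Omega -> R) (eps : R) : H Y -> bdd_rv H Z -> H T ->
  E Y \is a fin_num -> E T \is a fin_num -> fine (E T) <= eps ->
  (forall w, Y w <= Z w + T w) -> fine (E Y) <= ev Z + eps.
Proof.
move=> HY bZ HT fY fT Te YZ; have [HZ _] := bZ.
rewrite -lee_fin fineK//; apply: (@le_trans _ _ (E (fun w => (Z w + T w)%R))).
  by apply: (sle_mono hE) => //; exact: (rv_add hH).
apply: (le_trans (sle_subadd hE HZ HT _)).
  by rewrite (evE hH hE bZ); exact: fin_num_adde_defr.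
by rewrite (evE hH hE bZ) -(fineK fT) -EFinD lee_fin lerD2l.
Qed.

(** Extends the agreement of upper and lower expectations from bounded
    functions to [X 0] itself by truncation. *)
Lemma mean_eq_conjugate : E (X 0%N) = conjugate E (X 0%N).
Proof.
have fX := fin_num_mean hH hE HX tailX.
have fN := fin_num_meanN hH hE HX tailX.
have HN := rv_opp hH (HX 0).
rewrite /conjugate -(fineK fX) -(fineK fN) -EFinN; congr EFin.
apply/eqP; rewrite -addr_eq0 eq_le; apply/andP; split; last first.
  rewrite -lee_fin EFinD !fineK//.
  have := sle_subadd hE (HX 0) HN; rewrite (_ : (fun w => _ + _) = fun=> 0).
    by rewrite (sle_cst hE); apply; exact: fin_num_adde_defr.
  by apply/funext => w; rewrite subrr.
apply/ler_addgt0Pr => e e0; rewrite add0r.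
have e20 : 0 < e / 2 by rewrite divr_gt0.
have [c c0 [fT Te]] := excess_small tailX e20.
have HT := rv_excess hH c (HX 0).
have bh := blip_clamp (- c) c.
have cert := mean_certainty hH hE HX indX idX cV bh.
have excess x : `|x - clamp (- c) c x| <= Num.max (`|x| - c) 0.
  rewrite /clamp /Order.max /Order.min.
  have [x0|x0] := leP 0 x.
    rewrite (ger0_norm x0); case: (ltP x (- c)) => h1; case: ltP => h2;
    case: ltP => h3; rewrite ler_norml; apply/andP; split; lra.
  rewrite (ltr0_norm x0); case: (ltP x (- c)) => h1; case: ltP => h2;
  case: ltP => h3; rewrite ler_norml; apply/andP; split; lra.
have le1 : fine (E (X 0%N)) <= ev (fun w => clamp (- c) c (X 0%N w)) + e / 2.
  apply: (mean_le_of_excess (HX 0) (bdd_blip hH bh (HX 0)) HT fX fT Te) => w.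
  by rewrite -lerBlDl (le_trans (ler_norm _))// excess.
have le2 : fine (E (fun w => - X 0%N w)) <=
    ev (fun w => - clamp (- c) c (X 0%N w)) + e / 2.
  apply: (mean_le_of_excess HN (bddN hH (bdd_blip hH bh (HX 0))) HT fN fT Te) => w.
  rewrite -lerBlDl opprK (le_trans _ (excess _))// addrC -normrN opprB ler_norm//.
lra.
Qed.

End IndependentStrongLaw.

Lemma cluster_set_cvg (R : realType) (u : R^nat) (l : R) :
  u @ \oo --> l -> cluster_set u = [set l].
Proof.
move=> ul; apply/seteqP; split=> x /=.
  move=> [f fi fx]; have fcv : f @ \oo --> \oo.
    have fn n : (n <= f n)%N.
      by elim: n => // n IH; exact: leq_ltn_trans IH (fi _ _ (ltnSn n)).
    by apply/cvgnyPge => A; exists A => // n /= An; exact: leq_trans An (fn n).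
  have cl : u \o f @ \oo --> l by exact: cvg_comp fcv ul.
  by rewrite -(cvg_lim _ fx)// -(cvg_lim _ cl).
by move=> ->; exists id.
Qed.

Theorem theorem3p3 (d : measure_display) (Omega : measurableType d)
    (R : realType) (H : set (Omega -> R)) (E : (Omega -> R) -> \bar R)
    (hH : rv_space H) (hE : sublinear_expectation H E) :
  let V := capacity H E in
  let liminf_mean (X : nat -> Omega -> R) w :=
    limn_einf (fun n => (sample_mean X w n)%:E) in
  let limsup_mean (X : nat -> Omega -> R) w :=
    limn_esup (fun n => (sample_mean X w n)%:E) in
  (forall X : nat -> Omega -> R,
    (forall n, H (X n)) ->
    negatively_dependent_seq E X ->
    identically_distributed E X ->
    countably_subadditive V ->
    (choquet V (fun w => `|X 0%N w|%R) < +oo)%E ->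
    E (fun w => Num.max (`|X 0%N w| - c) 0) @[c --> +oo%R] --> 0%E ->
    V ([set w | (liminf_mean X w < conjugate E (X 0%N))%E] `|`
       [set w | (E (X 0%N) < limsup_mean X w)%E]) = 0%E)
  /\
  (forall X : nat -> Omega -> R,
    (forall n, H (X n)) ->
    independent_seq H E X ->
    identically_distributed E X ->
    continuous_capacity V ->
    (V [set w | limn_esup (fun n => `|sample_mean X w n|%:E) = +oo%E] < 1)%E ->
    (choquet V (fun w => `|X 0%N w|%R) < +oo)%E)
  /\
  (forall X : nat -> Omega -> R,
    (forall n, H (X n)) ->
    independent_seq H E X ->
    identically_distributed E X ->
    (choquet V (fun w => `|X 0%N w|%R) < +oo)%E ->
    E (fun w => Num.max (`|X 0%N w| - c) 0) @[c --> +oo%R] --> 0%E ->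
    continuous_capacity V ->
    V [set w | liminf_mean X w = conjugate E (X 0%N) /\
               limsup_mean X w = E (X 0%N)] = 1%E
    /\
    V [set w | cluster_set (sample_mean X w) =
               [set l : R | (conjugate E (X 0%N) <= l%:E <= E (X 0%N))%E]]
      = 1%E).
Proof.
move=> V liminf_mean limsup_mean; split; [|split].
- move=> X HX ndX idX sV chX tailX.
  have [|N [_ N0 hN]] := strong_law_null hH hE HX idX _ sV chX tailX.
    by move=> f n bf f0 fm; exact: (ev_prod_negatively_dependent hH hE HX n ndX idX bf f0 fm).
  apply/eqP; rewrite eq_le (cap_ge0 hH hE) andbT -N0; apply: cap_mono => w bad.
  apply: contrapT => /hN[h1 h2]; case: bad => /=; apply/negP.
    by rewrite -leNgt.
  by rewrite -leNgt.
- by move=> X HX indX idX cV; exact: choquet_lty_of_limsup_bounded.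
- move=> X HX indX idX chX tailX cV.
  have sV := continuous_countably_subadditive hH hE cV.
  have [|N [_ N0 hN]] := strong_law_null hH hE HX idX _ sV chX tailX.
    by move=> f n bf f0 _; rewrite (ev_prod_identical hH hE HX indX idX n bf f0).
  have EX := mean_eq_conjugate hH hE HX indX idX cV tailX.
  have fX := fin_num_mean hH hE HX tailX.
  (* the complement of a null set has capacity 1, by sub-additivity *)
  have one (A : set Omega) : ~` N `<=` A -> V A = 1%E.
    move=> NA; apply/eqP; rewrite eq_le (cap_le1 hH hE)/=.
    apply: (le_trans _ (cap_setC hH hE A)).
    have -> : capacity H E (~` A) = 0%E; last by rewrite sube0.
    apply/eqP; rewrite eq_le (cap_ge0 hH hE) andbT -N0; apply: cap_mono => w wA.
    by apply: contrapT => /NA.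
  split; apply: one => w /hN[h1 h2] /=.
    have h3 := limn_einf_sup (fun n => (sample_mean X w n)%:E).
    rewrite -EX in h1 *; split; apply/eqP; rewrite eq_le.
      by rewrite h1 (le_trans h3 h2).
    by rewrite h2 (le_trans h1 h3).
  rewrite -EX in h1 *; rewrite -(fineK fX) in h1 h2 *.
  have /fine_cvgP[_ cv] := cvg_of_limsup_le_liminf h2 h1.
  rewrite (cluster_set_cvg cv).
  apply/seteqP; split=> l /=.
    by move=> ->; rewrite lexx.
  by rewrite !lee_fin => hl; apply/eqP; rewrite eq_le andbC.
Qed.
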